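(* Consider the three-stage problem (P) and Algorithm B described in the context, with $\alpha\in(0,1)$, $\sigma>0$, $\tau\in\big(0,\tfrac{1+\sqrt{5-4\alpha}}{2}\big]$ and a summable sequence of nonnegative tolerances $\{\varepsilon_k\}_{k\ge0}$. Suppose that the solution set $\bar\Omega$ of the KKT system of (P) is nonempty, and that $P_x^k-Q\preceq\frac{2\alpha}{\sigma}I$ (for all $k$ and all points of $\bar\Omega$, with $P^k_x$ as in the context). Let $\{\varpi^k\}=\{(m^k,n^k,x^k)\}$ be generated by Algorithm B. Then $\{\varpi^k\}$ converges to a point in $\bar\Omega$.
   Context: **Problem.** Let $d,\ell,N_2,N_3$ be positive integers. The three-stage problem is $$(P)\qquad \min_{x_1,x_2,x_3}\ \sum_{t=1}^3\big(\theta_t(x_t)+\delta_{\mathcal K_t}(x_t)+h_t(x_t)\big)\quad\text{s.t. } A_1x_1=b_1,\ B_2x_1+A_2x_2=b_2,\ B_3x_2+A_3x_3=b_3,$$ with $x_1\in\mathbb R^d$, $x_2=(x_{2,i})_{i\le N_2}\in\mathbb R^{dN_2}$, $x_3=(x_{3,ij})_{i\le N_2,j\le N_3}\in\mathbb R^{dN_2N_3}$. Here $\theta_t$ is closed proper convex, $h_t$ is convex and continuously differentiable with Lipschitz gradient, $\mathcal K_t$ is a nonempty closed convex set and $\delta_{\mathcal K_t}$ its indicator function. Stage functions are scenario averages, $\theta_2(x_2)=\frac1{N_2}\sum_i\theta_{2,i}(x_{2,i})$, $\theta_3(x_3)=\frac1{N_2N_3}\sum_{i,j}\theta_{3,ij}(x_{3,ij})$,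 similarly $h_2,h_3$; $\mathcal K_2,\mathcal K_3$ are Cartesian products over scenarios; $A_2=\mathrm{diag}(A_{2,i})$, $A_3=\mathrm{diag}(A_{3,ij})$, $B_2$ is the vertical stack of the $B_{2,i}$, and $B_3=\mathrm{diag}(B_{3,1},\dots,B_{3,N_2})$ with $B_{3,i}$ the vertical stack of $B_{3,i1},\dots,B_{3,iN_3}$; all of $A_1,A_{2,i},A_{3,ij},B_{2,i},B_{3,ij}$ are linear maps $\mathbb R^d\to\mathbb R^\ell$. A superscript $*$ on a linear map is the adjoint and on a convex function the Fenchel conjugate. **Minorization data.** $Q_t$ ($t=1,2,3$) are self-adjoint positive semidefinite operators on the space of $x_t$ with $h_t(x_t)\ge h_t(x_t')+\langle\nabla h_t(x_t'),x_t-x_t'\rangle+\frac12\langle x_t-x_t',Q_t(x_t-x_t')\rangle$ for all $x_t,x_t'$. Put $\mathcal W_t=\mathrm{Range}(Q_t)$, $Q=\mathrm{diag}(Q_1,Q_2,Q_3)$, $x=(x_1;x_2;x_3)$, $h(x)=\sum_th_t(x_t)$, $c(x')=\nabla h(x')-Qx'$. Convention: $B_4^*=0$, $y_4=0$. **Grouped dual variables.** $m=(v_1,v_2,v_3;w_1,w_2,w_3)$, $n=(z_1,z_2,z_3;y_1,y_2,y_3)$, where $v_t,w_t,z_t$ live in the space of $x_t$, $w_t\in\mathcal W_t$, and $y_t$ lives in the space of $b_t$. Put $\mathcal F^*m=(v_t-Q_tw_t)_{t=1,2,3}$, $\mathcal G^*n=(z_t+A_t^*y_t+B_{t+1}^*y_{t+1})_{t=1,2,3}$,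 $p(m)=\sum_t\theta_t^*(-v_t)$, $q(n)=\sum_t\delta^*_{\mathcal K_t}(-z_t)$, $g(n)=-\sum_t\langle b_t,y_t\rangle$, $f(m;x')=\sum_t\big(\frac12\langle w_t,Q_tw_t\rangle+\delta_{\mathcal W_t}(w_t)-h_t(x_t')-\frac12\langle x_t',Q_tx_t'\rangle+\langle\nabla h_t(x_t'),x_t'\rangle\big)$; $\partial_mf(m;x')$ does not depend on $x'$ and is written $\partial_mf(m)$. For $\sigma>0$, $$\widehat L^{x'}_\sigma(m,n;x)=p(m)+f(m;x')+q(n)+g(n)-\tfrac1{2\sigma}\|x\|^2+\tfrac\sigma2\|\mathcal F^*m+\mathcal G^*n-c(x')+\sigma^{-1}x\|^2.$$ **sGS operators.** For a self-adjoint block operator $\mathcal H=\mathcal H_d+\mathcal H_u+\mathcal H_u^*$ with block-diagonal part $\mathcal H_d\succ0$ and strictly block upper triangular part $\mathcal H_u$, put $\mathrm{sGS}(\mathcal H)=\mathcal H_u\mathcal H_d^{-1}\mathcal H_u^*$. Let $\widetilde Q=\mathrm{diag}(0,Q)$ (acting on $m=(v;w)$), $\widetilde{\mathcal M}=\widetilde Q+\sigma\mathcal F\mathcal F^*$, $\widetilde{\mathcal N}=\sigma\mathcal G\mathcal G^*$, $\mathcal S=\mathrm{sGS}(\widetilde{\mathcal M})$, $\mathcal T=\mathrm{sGS}(\widetilde{\mathcal N})$ (blocks being the components of $m$ and $n$), $\mathcal M=\widetilde{\mathcal M}+\mathcal S$, $\mathcal N=\widetilde{\mathcal N}+\mathcal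 T$. Operators on the $m$-space are regarded on the subspace where $w_t\in\mathcal W_t$. It is assumed that the block-diagonal parts of $\widetilde{\mathcal M}$ and $\widetilde{\mathcal N}$ are positive definite (for $\widetilde{\mathcal N}$: $A_1A_1^*\succ0$ and $A_tA_t^*+B_tB_t^*\succ0$ for $t=2,3$); then $\mathcal M\succ0$, $\mathcal N\succ0$. **Algorithm B (SL-MD-isPADMM).** Start from any $(m^0,n^0,x^0)$. Given $(m^k,n^k,x^k)$: (1) choose $m^{k+1}$ such that there is $d_m^k\in\partial_m\widehat L^{x^k}_\sigma(m^{k+1},n^k;x^k)+\mathcal S(m^{k+1}-m^k)$ with $\|\mathcal M^{-1/2}d_m^k\|\le\varepsilon_k$; (2) choose $n^{k+1}$ such that there is $d_n^k\in\partial_n\widehat L^{x^k}_\sigma(m^{k+1},n^{k+1};x^k)+\mathcal T(n^{k+1}-n^k)$ with $\|\mathcal N^{-1/2}d_n^k\|\le\varepsilon_k$; (3) $x^{k+1}=x^k+\tau\sigma(\mathcal F^*m^{k+1}+\mathcal G^*n^{k+1}-c(x^k))$. **KKT set.** $\bar\Omega$ is the set of $(m,n,x)$ with $0\in\partial p(m)+\partial_mf(m)+\mathcal Fx$, $0\in\partial q(n)+\nabla g(n)+\mathcal Gx$, $\mathcal F^*m+\mathcal G^*n=\nabla h(x)-Qx$. Equivalently: $x$ satisfies the linear constraints of (P); $\nabla h_t(x_t)-A_t^*y_t-B_{t+1}^*y_{t+1}-v_t-z_t=0$; $x_t\in\partial\theta_t^*(-v_t)$; $x_t\in\partial\delta^*_{\mathcal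 K_t}(-z_t)$; and $w_t\in\mathcal W_t$, $Q_tw_t=Q_tx_t$, for $t=1,2,3$. **The operators $P_x^k$.** For $(\bar m,\bar n,\bar x)\in\bar\Omega$ and an iterate $x^k$, $P_x^k$ is a self-adjoint operator in the convex hull of the generalized (Clarke) Hessians $\partial^2h$ at points of the segment $[\bar x,x^k]$ such that $\nabla h(x^k)-\nabla h(\bar x)=P_x^k(x^k-\bar x)$ and $Q\preceq P_x^k$ (such an operator exists by Clarke's mean value theorem and the lower bound defining $Q$). *)

(* Defs.v *)
From HB Require Import structures.
From mathcomp Require Import all_boot all_order all_algebra.
From mathcomp Require Import all_classical all_reals all_analysis.

Set Implicit Arguments.
Unset Strict Implicit.
Unset Printing Implicit Defensive.

Import Order.TTheory GRing.Theory Num.Theory.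
Import numFieldNormedType.Exports.

Local Open Scope classical_set_scope.
Local Open Scope ring_scope.

(* R^n is 'cV[R]_n, linear maps are matrices acting on the left, adjoints are
   transposes. The library norm `|_| on 'cV[R]_n is the sup norm, so the
   Euclidean one is introduced here; the topologies agree. *)

Definition dotv (R : realType) (n : nat) (u v : 'cV[R]_n) : R :=
  (u^T *m v) 0 0.

Definition enorm (R : realType) (n : nat) (u : 'cV[R]_n) : R :=
  Num.sqrt (dotv u u).

Definition is_psd (R : realType) (n : nat) (H : 'M[R]_n) : Prop :=
  H^T = H /\ forall u, 0 <= dotv u (H *m u).

Definition pos_def_on (R : realType) (n : nat) (U : set 'cV[R]_n)
    (H : 'M[R]_n) : Prop :=
  H^T = H /\ forall u, U u -> u != 0 -> 0 < dotv u (H *m u).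

(* S = K^(1/2) *)
Definition is_psd_sqrt (R : realType) (n : nat) (K S : 'M[R]_n) : Prop :=
  is_psd S /\ S *m S = K.

Definition proper (R : realType) (n : nat) (f : 'cV[R]_n -> \bar R) : Prop :=
  (exists x, (f x < +oo)%E) /\ forall x, (-oo < f x)%E.

Definition econvex (R : realType) (n : nat) (f : 'cV[R]_n -> \bar R) : Prop :=
  forall (x y : 'cV[R]_n) (t : R), 0 < t < 1 ->
    (f (t *: x + (1 - t) *: y)%R <= t%:E * f x + (1 - t)%:E * f y)%E.

Definition closed_proper_convex (R : realType) (n : nat)
    (f : 'cV[R]_n -> \bar R) : Prop :=
  [/\ lower_semicontinuous f, proper f & econvex f].

Definition indic_fun (R : realType) (n : nat) (K : set 'cV[R]_n)
    (x : 'cV[R]_n) : \bar R :=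
  if x \in K then 0%E else +oo%E.

Definition conjugate (R : realType) (n : nat) (f : 'cV[R]_n -> \bar R)
    (v : 'cV[R]_n) : \bar R :=
  ereal_sup [set ((dotv v x)%:E - f x)%E | x in [set: 'cV[R]_n]].

Definition subdiff (R : realType) (n : nat) (f : 'cV[R]_n -> \bar R)
    (x : 'cV[R]_n) : set 'cV[R]_n :=
  [set v | f x \is a fin_num /\
           forall y, (f x + (dotv v (y - x)%R)%:E <= f y)%E].

Definition grad (R : realType) (n : nat) (h : 'cV[R]_n -> R)
    (x : 'cV[R]_n) : 'cV[R]_n :=
  \col_i ('D_(delta_mx i 0) (h : 'cV[R]_n -> R^o) x).

Definition convex_C11 (R : realType) (n : nat) (h : 'cV[R]_n -> R) : Prop :=
  [/\ convex_function setT h,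
      forall x, differentiable (h : 'cV[R]_n -> R^o) x &
      exists L : R, forall x y,
        enorm (grad h x - grad h y) <= L * enorm (x - y)].

Definition is_jacobian (R : realType) (n : nat) (g : 'cV[R]_n -> 'cV[R]_n)
    (x : 'cV[R]_n) (H : 'M[R]_n) : Prop :=
  differentiable g x /\ forall v, 'd g x v = H *m v.

Definition convex_hull (R : realType) (V : lmodType R) (A : set V) : set V :=
  [set a | forall C : set V, convex_set C -> A `<=` C -> C a].

(* Clarke's generalized Hessian of h: the convex hull of all limits of
   Jacobians of grad h along differentiability points converging to x. *)
Definition clarke_hessian (R : realType) (n : nat) (h : 'cV[R]_n -> R)
    (x : 'cV[R]_n) : set 'M[R]_n :=
  convex_hull [set H : 'M[R]_n |
    exists (u : nat -> 'cV[R]_n) (J : nat -> 'M[R]_n),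
      [/\ u @ \oo --> x, forall k, is_jacobian (grad h) (u k) (J k)
        & J @ \oo --> H]].

Definition segm (R : realType) (n : nat) (a b : 'cV[R]_n) : set 'cV[R]_n :=
  [set (1 - t) *: a + t *: b | t in [set t : R | 0 <= t <= 1]].

Definition mxrange (R : realType) (m n : nat) (Q : 'M[R]_(m, n)) :
    set 'cV[R]_m :=
  [set Q *m u | u in [set: 'cV[R]_n]].

(* Coordinate i lies in block number [reshape_index sh i], where sh lists the
   sizes of the consecutive blocks. *)
Definition diag_part (R : realType) (n : nat) (sh : seq nat) (H : 'M[R]_n) :
    'M[R]_n :=
  \matrix_(i, j)
    (if reshape_index sh i == reshape_index sh j then H i j else 0).

Definition upper_part (R : realType) (n : nat) (sh : seq nat) (H : 'M[R]_n) :
    'M[R]_n :=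
  \matrix_(i, j)
    (if (reshape_index sh i < reshape_index sh j)%N then H i j else 0).

Definition sGS (R : realType) (n : nat) (sh : seq nat)
    (inv : 'M[R]_n -> 'M[R]_n) (H : 'M[R]_n) : 'M[R]_n :=
  upper_part sh H *m inv (diag_part sh H) *m (upper_part sh H)^T.

(* Let the columns of E be a basis of a subspace U and let the self-adjoint
   operator H map U to itself, bijectively. Then [inv_on E H] is the inverse
   of the restriction of H to U, extended by 0 on the orthogonal complement
   of U; it does not depend on the choice of E. *)
Definition inv_on (R : realType) (n r : nat) (E : 'M[R]_(n, r))
    (H : 'M[R]_n) : 'M[R]_n :=
  E *m invmx (E^T *m H *m E) *m E^T.

(* The dimension of N copies of R^k. *)
Definition scen (N k : nat) : nat := (\sum_(i < N) k)%N.

(* The dimension of the three stages together, for k = d (primal) and k = l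
   (constraints). *)
Definition tot (N2 N3 k : nat) : nat :=
  (k + (scen N2 k + scen N2 (scen N3 k)))%N.

Definition scenario (R : realType) (N k : nat) (x : 'cV[R]_(scen N k))
    (i : 'I_N) : 'cV[R]_k :=
  submxcol (p_ := fun=> k) x i.

Definition st1 (R : realType) (N2 N3 k : nat) (x : 'cV[R]_(tot N2 N3 k)) :
  'cV[R]_k := usubmx x.
Definition st2 (R : realType) (N2 N3 k : nat) (x : 'cV[R]_(tot N2 N3 k)) :
  'cV[R]_(scen N2 k) := usubmx (dsubmx x).
Definition st3 (R : realType) (N2 N3 k : nat) (x : 'cV[R]_(tot N2 N3 k)) :
  'cV[R]_(scen N2 (scen N3 k)) := dsubmx (dsubmx x).

(* diag(A_1, ..., A_N), with rectangular blocks *)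
Definition scen_diag (R : realType) (N p q : nat) (A : 'I_N -> 'M[R]_(p, q)) :
    'M[R]_(scen N p, scen N q) :=
  \mxblock_(i < N, j < N) (if i == j then A i else 0).

Definition scen_stack (R : realType) (N p q : nat) (A : 'I_N -> 'M[R]_(p, q)) :
    'M[R]_(scen N p, q) :=
  \mxcol_(i < N) A i.

(* Problem data, together with the minorization operators Q_t. *)
Record three_stage (R : realType) (d l N2 N3 : nat) := ThreeStage {
  theta1  : 'cV[R]_d -> \bar R;
  theta2s : 'I_N2 -> 'cV[R]_d -> \bar R;
  theta3s : 'I_N2 -> 'I_N3 -> 'cV[R]_d -> \bar R;
  h1  : 'cV[R]_d -> R;
  h2s : 'I_N2 -> 'cV[R]_d -> R;
  h3s : 'I_N2 -> 'I_N3 -> 'cV[R]_d -> R;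
  K1  : set 'cV[R]_d;
  K2s : 'I_N2 -> set 'cV[R]_d;
  K3s : 'I_N2 -> 'I_N3 -> set 'cV[R]_d;
  A1  : 'M[R]_(l, d);
  A2s : 'I_N2 -> 'M[R]_(l, d);
  A3s : 'I_N2 -> 'I_N3 -> 'M[R]_(l, d);
  B2s : 'I_N2 -> 'M[R]_(l, d);
  B3s : 'I_N2 -> 'I_N3 -> 'M[R]_(l, d);
  b1  : 'cV[R]_l;
  b2  : 'cV[R]_(scen N2 l);
  b3  : 'cV[R]_(scen N2 (scen N3 l));
  Q1  : 'M[R]_d;
  Q2  : 'M[R]_(scen N2 d);
  Q3  : 'M[R]_(scen N2 (scen N3 d))
}.

Section Problem.
Context {R : realType} {d l N2 N3 : nat} (D : three_stage R d l N2 N3).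

Local Notation X1 := 'cV[R]_d.
Local Notation X2 := 'cV[R]_(scen N2 d).
Local Notation X3 := 'cV[R]_(scen N2 (scen N3 d)).
Local Notation dX := (tot N2 N3 d).
Local Notation dY := (tot N2 N3 l).
Local Notation X := 'cV[R]_dX.
(* m = (v; w) with v, w in X, and n = (z; y) with z in X, y in Y *)
Local Notation Mspace := 'cV[R]_(dX + dX).
Local Notation Nspace := 'cV[R]_(dX + dY).

Definition theta2 (x : X2) : \bar R :=
  ((N2%:R^-1)%:E * \sum_(i < N2) theta2s D i (scenario x i))%E.
Definition theta3 (x : X3) : \bar R :=
  (((N2 * N3)%:R^-1)%:E *
    \sum_(i < N2) \sum_(j < N3) theta3s D i j (scenario (scenario x i) j))%E.

Definition h2 (x : X2) : R :=
  N2%:R^-1 * \sum_(i < N2) h2s D i (scenario x i).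
Definition h3 (x : X3) : R :=
  (N2 * N3)%:R^-1 *
    \sum_(i < N2) \sum_(j < N3) h3s D i j (scenario (scenario x i) j).
Definition hfun (x : X) : R := h1 D (st1 x) + h2 (st2 x) + h3 (st3 x).

Definition K2 : set X2 := [set x | forall i, K2s D i (scenario x i)].
Definition K3 : set X3 :=
  [set x | forall i j, K3s D i j (scenario (scenario x i) j)].

Definition A2 := scen_diag (A2s D).
Definition A3 := scen_diag (fun i => scen_diag (A3s D i)).
Definition B2 := scen_stack (B2s D).
Definition B3 := scen_diag (fun i => scen_stack (B3s D i)).

(* The linear constraints of the problem are [Amx *m x = (b1; b2; b3)]. *)
Definition Amx : 'M[R]_(dY, dX) :=
  block_mx (A1 D) 0 (col_mx B2 0) (block_mx A2 0 B3 A3).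

Definition Qmx : 'M[R]_dX :=
  block_mx (Q1 D) 0 0 (block_mx (Q2 D) 0 0 (Q3 D)).

Definition minorizes (k : nat) (ht : 'cV[R]_k -> R) (Qt : 'M[R]_k) : Prop :=
  is_psd Qt /\
  forall u u', ht u' + dotv (grad ht u') (u - u')
               + 2^-1 * dotv (u - u') (Qt *m (u - u')) <= ht u.

Definition cvec (x' : X) : X := grad hfun x' - Qmx *m x'.

Definition Fadj : 'M[R]_(dX, dX + dX) := row_mx 1%:M (- Qmx).
Definition Fmx : 'M[R]_(dX + dX, dX) := Fadj^T.
(* z + Amx^T y, that is (z_t + A_t^T y_t + B_{t+1}^T y_{t+1})_t *)
Definition Gadj : 'M[R]_(dX, dX + dY) := row_mx 1%:M Amx^T.
Definition Gmx : 'M[R]_(dX + dY, dX) := Gadj^T.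

Definition pfun (m : Mspace) : \bar R :=
  (conjugate (theta1 D) (- st1 (usubmx m))
   + conjugate theta2 (- st2 (usubmx m))
   + conjugate theta3 (- st3 (usubmx m)))%E.

Definition qfun (n : Nspace) : \bar R :=
  (conjugate (indic_fun (K1 D)) (- st1 (usubmx n))
   + conjugate (indic_fun K2) (- st2 (usubmx n))
   + conjugate (indic_fun K3) (- st3 (usubmx n)))%E.

Definition glin (n : Nspace) : R :=
  - (dotv (b1 D) (st1 (dsubmx n)) + dotv (b2 D) (st2 (dsubmx n))
     + dotv (b3 D) (st3 (dsubmx n))).

Definition f_stage (k : nat) (Qt : 'M[R]_k) (ht : 'cV[R]_k -> R)
    (w x' : 'cV[R]_k) : \bar R :=
  ((2^-1 * dotv w (Qt *m w))%:E + indic_fun (mxrange Qt) w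
   + (- ht x' - 2^-1 * dotv x' (Qt *m x') + dotv (grad ht x') x')%:E)%E.

Definition fquad (m : Mspace) (x' : X) : \bar R :=
  (f_stage (Q1 D) (h1 D) (st1 (dsubmx m)) (st1 x')
   + f_stage (Q2 D) h2 (st2 (dsubmx m)) (st2 x')
   + f_stage (Q3 D) h3 (st3 (dsubmx m)) (st3 x'))%E.

(* The m-space proper: w_t in Range(Q_t). *)
Definition mspace : set Mspace :=
  [set m | [/\ mxrange (Q1 D) (st1 (dsubmx m)),
               mxrange (Q2 D) (st2 (dsubmx m)) &
               mxrange (Q3 D) (st3 (dsubmx m))]].

(* The columns form a basis of [mspace]. *)
Definition mbasis : 'M[R]_(dX + dX, dX + \rank Qmx) :=
  block_mx 1%:M 0 0 (col_base Qmx).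

Section Sigma.
Variable sigma : R.

Definition penalty (x' : X) (m : Mspace) (n : Nspace) (x : X) : R :=
  sigma / 2 *
    enorm (Fadj *m m + Gadj *m n - cvec x' + sigma^-1 *: x) ^+ 2.

Definition Lhat (x' : X) (m : Mspace) (n : Nspace) (x : X) : \bar R :=
  (pfun m + fquad m x' + qfun n
   + (glin n - (2 * sigma)^-1 * enorm x ^+ 2 + penalty x' m n x)%:E)%E.

(* The terms of [Lhat] that depend on m, resp. on n. The partial
   subdifferentials of [Lhat] are those of these functions: the remaining
   summands are constant, and must not enter since qfun n may be +oo at the
   initial point n^0. *)
Definition Lhat_m (x' : X) (n : Nspace) (x : X) (m : Mspace) : \bar R :=
  (pfun m + fquad m x' + (penalty x' m n x)%:E)%E.
Definition Lhat_n (x' : X) (m : Mspace) (x : X) (n : Nspace) : \bar R :=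
  (qfun n + (glin n + penalty x' m n x)%:E)%E.

Lemma Lhat_mE x' m n x : Lhat x' m n x =
  (Lhat_m x' n x m
   + (qfun n + (glin n - (2 * sigma)^-1 * enorm x ^+ 2)%:E))%E.
Proof. by rewrite /Lhat /Lhat_m [RHS]addeACA (addeC (_%:E)) -EFinD. Qed.

Lemma Lhat_nE x' m n x : Lhat x' m n x =
  (Lhat_n x' m x n
   + (pfun m + fquad m x' - ((2 * sigma)^-1 * enorm x ^+ 2)%:E))%E.
Proof.
by rewrite /Lhat /Lhat_n [RHS]addeACA -EFinB (addrAC (glin n)) (addeC (qfun n)).
Qed.

Definition shape_m : seq nat :=
  [:: d; scen N2 d; scen N2 (scen N3 d); d; scen N2 d; scen N2 (scen N3 d)].
Definition shape_n : seq nat :=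
  [:: d; scen N2 d; scen N2 (scen N3 d); l; scen N2 l; scen N2 (scen N3 l)].

Definition Mtilde : 'M[R]_(dX + dX) :=
  block_mx 0 0 0 Qmx + sigma *: (Fmx *m Fadj).
Definition Ntilde : 'M[R]_(dX + dY) := sigma *: (Gmx *m Gadj).

Definition Sop : 'M[R]_(dX + dX) := sGS shape_m (inv_on mbasis) Mtilde.
Definition Top : 'M[R]_(dX + dY) := sGS shape_n invmx Ntilde.
Definition Mop : 'M[R]_(dX + dX) := Mtilde + Sop.
Definition Nop : 'M[R]_(dX + dY) := Ntilde + Top.

(* In the first two steps, the matrix H is M^(-1/2), resp. N^(-1/2). *)
Definition algorithmB (tau : R) (eps : nat -> R)
    (m : nat -> Mspace) (n : nat -> Nspace) (x : nat -> X) : Prop :=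
  mspace (m 0%N) /\
  forall k : nat,
  [/\ exists dm, [/\ mspace dm,
        subdiff (Lhat_m (x k) (n k) (x k)) (m k.+1)
          (dm - Sop *m (m k.+1 - m k)) &
        exists2 H, is_psd_sqrt (inv_on mbasis Mop) H &
          enorm (H *m dm) <= eps k],
      exists dn,
        subdiff (Lhat_n (x k) (m k.+1) (x k)) (n k.+1)
          (dn - Top *m (n k.+1 - n k)) /\
        exists2 H, is_psd_sqrt (invmx Nop) H & enorm (H *m dn) <= eps k
    & x k.+1 =
        x k + (tau * sigma) *: (Fadj *m m k.+1 + Gadj *m n k.+1 - cvec (x k))].

End Sigma.

(* The subdifferential of fquad(_; x') does not depend on x'; x' := x is
   used. *)
Definition KKT (m : Mspace) (n : Nspace) (x : X) : Prop :=
  [/\ exists u s, [/\ subdiff pfun m u, subdiff (fquad^~ x) m s &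
                      u + s + Fmx *m x = 0],
      exists2 u, subdiff qfun n u & u + grad glin n + Gmx *m x = 0
    & Fadj *m m + Gadj *m n = grad hfun x - Qmx *m x].

Definition mean_value_op (xbar xk : X) (Pk : 'M[R]_dX) : Prop :=
  [/\ Pk^T = Pk,
      convex_hull (\bigcup_(z in segm xbar xk) clarke_hessian hfun z) Pk,
      grad hfun xk - grad hfun xbar = Pk *m (xk - xbar) &
      is_psd (Pk - Qmx)].

Definition standing_assumptions : Prop :=
  [/\ [/\ (0 < d)%N, (0 < l)%N, (0 < N2)%N & (0 < N3)%N],
      [/\ closed_proper_convex (theta1 D), closed_proper_convex theta2 &
          closed_proper_convex theta3],
      [/\ convex_C11 (h1 D), convex_C11 h2 & convex_C11 h3],
      [/\ [/\ K1 D !=set0, closed (K1 D) & convex_set (K1 D)],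
          [/\ K2 !=set0, closed K2 & convex_set K2] &
          [/\ K3 !=set0, closed K3 & convex_set K3]] &
      [/\ minorizes (h1 D) (Q1 D), minorizes h2 (Q2 D) &
          minorizes h3 (Q3 D)]].

End Problem.

Arguments shape_m : clear implicits.
Arguments shape_n : clear implicits.

(* Main.v *)
Require Import Defs.
From mathcomp Require Import all_boot all_order all_algebra.
From mathcomp Require Import all_classical all_reals all_analysis.
From mathcomp Require Import ring lra.

Import Order.TTheory GRing.Theory Num.Theory.
Import numFieldNormedType.Exports.

(* Fix a KKT point and write E = P_x - Q, so that c(x^k) - c(xbar) = E (x^k - xbar)
   and, by E <= (2 alpha / sigma) I, |E u|^2 <= (2 alpha / sigma) <u, E u>.
   Adding the monotonicity inequalities of the two subdifferentials between the
   iterate and the KKT point, and of the n-subdifferential between consecutive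
   iterates, shows that
     |x - xbar|^2 / (tau sigma) + sigma |G^*(n - nbar)|^2 + |m - mbar|_S^2 + |n - nbar|_T^2
   plus multiples of |r|^2 (r the last residual) and of the last T-increment of n
   decreases by a positive multiple of |r|^2, |G^* Dn|^2, |Dm|_S^2, |Dn|_T^2 and
   |w - wbar|_Q^2, up to errors of order eps_k + eps_{k+1}; the bound on tau is
   exactly what makes the coefficients positive. The iterates are therefore bounded
   and the increments vanish. Along an ultrafilter refining the tails all sequences
   converge, and closedness of the subdifferentials makes the limit a KKT point; for
   that point the decreasing quantity tends to 0, which gives full convergence. *)

Set Implicit Arguments.
Unset Strict Implicit.
Unset Printing Implicit Defensive.

Local Open Scope classical_set_scope.
Local Open Scope ring_scope.

(** The inexactness shapes the argument. A tolerance on [M^(-1/2) d] yields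
    [2 <d, e> <= eps (1 + |e|_M^2)] for [e] in the m-space, so the energy inequality carries the
    full norm [|m - mbar|_M^2], of which the comparison function holds only the S-part. The Q-part
    is taken from the decrease, the F-part from the identity [Fa *m me = r - Ga *m ne + E *m xe].
    The error thus involves the next value and the decrease besides the current value; these are
    absorbed on the left once [eps] is small, and a summable relative error remains. The functions p
    and q enter only as suprema of affine functions. For a conjugate this is the definition, so
    convexity and lower semicontinuity need no biconjugation theorem. The remaining terms of the
    augmented Lagrangian are quadratic on a subspace; their gradients are split off by comparing
    orders in [t] along segments, so no sum rule with a qualification condition is used. *)

(** * Euclidean inner product and semidefinite matrices *)

Section Dot.
Context {R : realType}.

Lemma dotvE n (u v : 'cV[R]_n) : dotv u v = \sum_i u i 0 * v i 0.
Proof. by rewrite /dotv mxE; apply: eq_bigr => i _; rewrite mxE. Qed.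

Lemma dotvC n (u v : 'cV[R]_n) : dotv u v = dotv v u.
Proof. by rewrite !dotvE; apply: eq_bigr => i _; rewrite mulrC. Qed.

Lemma dotvDr n (u v w : 'cV[R]_n) : dotv u (v + w) = dotv u v + dotv u w.
Proof. by rewrite /dotv mulmxDr mxE. Qed.

Lemma dotvDl n (u v w : 'cV[R]_n) : dotv (v + w) u = dotv v u + dotv w u.
Proof. by rewrite dotvC dotvDr dotvC [dotv u w]dotvC. Qed.

Lemma dotvZr n (a : R) (u v : 'cV[R]_n) : dotv u (a *: v) = a * dotv u v.
Proof. by rewrite /dotv -scalemxAr mxE. Qed.

Lemma dotvZl n (a : R) (u v : 'cV[R]_n) : dotv (a *: u) v = a * dotv u v.
Proof. by rewrite dotvC dotvZr dotvC. Qed.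

Lemma dotvNr n (u v : 'cV[R]_n) : dotv u (- v) = - dotv u v.
Proof. by rewrite -scaleN1r dotvZr mulN1r. Qed.

Lemma dotvNl n (u v : 'cV[R]_n) : dotv (- u) v = - dotv u v.
Proof. by rewrite dotvC dotvNr dotvC. Qed.

Lemma dotv0r n (u : 'cV[R]_n) : dotv u 0 = 0.
Proof. by rewrite -(scale0r 0) dotvZr mul0r. Qed.

Lemma dotv0l n (u : 'cV[R]_n) : dotv 0 u = 0.
Proof. by rewrite dotvC dotv0r. Qed.

Lemma dotv_mull m n (A : 'M[R]_(m, n)) u v :
  dotv (A *m u) v = dotv u (A^T *m v).
Proof. by rewrite /dotv trmx_mul mulmxA. Qed.

Lemma dotv_trl m n (A : 'M[R]_(m, n)) u v :
  dotv (A^T *m u) v = dotv u (A *m v).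
Proof. by rewrite dotv_mull trmxK. Qed.

Definition dotvL := (dotvDl, dotvDr, dotvNl, dotvNr, dotvZl, dotvZr).

Lemma dotv_ge0 n (u : 'cV[R]_n) : 0 <= dotv u u.
Proof. by rewrite dotvE; apply: sumr_ge0 => i _; rewrite -expr2 sqr_ge0. Qed.

Lemma dotv_eq0 n (u : 'cV[R]_n) : dotv u u = 0 -> u = 0.
Proof.
rewrite dotvE => /eqP; rewrite psumr_eq0; last first.
  by move=> i _; rewrite -expr2 sqr_ge0.
move/allP => h; apply/matrixP => i j; rewrite (ord1 j) mxE.
by have := h i (mem_index_enum i); rewrite /= mulf_eq0 orbb => /eqP.
Qed.

Lemma enorm_sqr n (u : 'cV[R]_n) : enorm u ^+ 2 = dotv u u.
Proof. by rewrite /enorm sqr_sqrtr // dotv_ge0. Qed.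

Lemma enorm_ge0 n (u : 'cV[R]_n) : 0 <= enorm u.
Proof. exact: sqrtr_ge0. Qed.

Lemma sym_dotv n (H : 'M[R]_n) u v :
  H^T = H -> dotv u (H *m v) = dotv v (H *m u).
Proof. by move=> hH; rewrite dotvC dotv_mull hH. Qed.

Lemma discr_le (a b c : R) : 0 <= c ->
  (forall t, 0 <= a + 2 * t * b + t ^+ 2 * c) -> b ^+ 2 <= a * c.
Proof.
rewrite le_eqVlt => /predU1P[<- h|c0 h].
  rewrite mulr0; have [->|b0] := eqVneq b 0; first by rewrite expr0n.
  have := h (- (a + 1) / (2 * b)).
  have -> : a + 2 * (- (a + 1) / (2 * b)) * b
      + (- (a + 1) / (2 * b)) ^+ 2 * 0 = -1 by field.
  by lra.
have := h (- b / c); rewrite -(pmulr_lge0 _ c0).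
have -> : (a + 2 * (- b / c) * b + (- b / c) ^+ 2 * c) * c = a * c - b ^+ 2.
  by field; lra.
by lra.
Qed.

Lemma psd_cauchy n (H : 'M[R]_n) u v : is_psd H ->
  dotv u (H *m v) ^+ 2 <= dotv u (H *m u) * dotv v (H *m v).
Proof.
move=> [hs hp]; apply: discr_le => [|t]; first exact: hp.
have := hp (u + t *: v).
rewrite !mulmxDr -!scalemxAr !dotvL (sym_dotv v u) //.
by move=> h; lra.
Qed.

Lemma psd1 n : is_psd (1%:M : 'M[R]_n).
Proof. by split=> [|u]; rewrite ?trmx1 // mul1mx dotv_ge0. Qed.

Lemma dotv_cauchy n (u v : 'cV[R]_n) :
  dotv u v ^+ 2 <= dotv u u * dotv v v.
Proof. by have := psd_cauchy u v (@psd1 n); rewrite !mul1mx. Qed.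

Lemma dotv_normD n (u v : 'cV[R]_n) :
  dotv (u + v) (u + v) <= 2 * dotv u u + 2 * dotv v v.
Proof.
have := dotv_ge0 (u - v); rewrite !dotvL (dotvC v u) => h; lra.
Qed.

Lemma psdD n (H K : 'M[R]_n) : is_psd H -> is_psd K -> is_psd (H + K).
Proof.
move=> [h1 h2] [k1 k2]; split; first by rewrite linearD /= h1 k1.
by move=> u; rewrite mulmxDl dotvDr addr_ge0.
Qed.

Lemma psdZ n (a : R) (H : 'M[R]_n) : 0 <= a -> is_psd H -> is_psd (a *: H).
Proof.
move=> a0 [h1 h2]; split; first by rewrite linearZ /= h1.
by move=> u; rewrite -scalemxAl dotvZr mulr_ge0.
Qed.

Lemma psd_gram m n (A : 'M[R]_(m, n)) : is_psd (A^T *m A).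
Proof.
split; first by rewrite trmx_mul trmxK.
by move=> u; rewrite -mulmxA -dotv_mull dotv_ge0.
Qed.

Lemma psd_congr m n (A : 'M[R]_(m, n)) H : is_psd H -> is_psd (A^T *m H *m A).
Proof.
move=> [h1 h2]; split; first by rewrite !trmx_mul trmxK h1 mulmxA.
by move=> u; rewrite -!mulmxA -dotv_mull.
Qed.

Lemma psd_block m n (H : 'M[R]_m) (K : 'M[R]_n) :
  is_psd H -> is_psd K -> is_psd (block_mx H 0 0 K).
Proof.
move=> [h1 h2] [k1 k2]; split; first by rewrite tr_block_mx h1 k1 !trmx0.
move=> u; rewrite -(vsubmxK u) mul_block_col !mul0mx addr0 add0r.
by rewrite /dotv tr_col_mx mul_row_col mxE addr_ge0 //; [exact: h2|exact: k2].
Qed.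

(* [beta] bounds the largest eigenvalue of E, so E^2 <= beta E. *)
Lemma psd_sqr_le n (E : 'M[R]_n) (beta : R) u :
  is_psd E -> is_psd (beta%:M - E) ->
  dotv (E *m u) (E *m u) <= beta * dotv u (E *m u).
Proof.
move=> hE [_ hB]; have [hs hp] := hE.
have := hB (E *m u); rewrite mulmxBl mul_scalar_mx !dotvL subr_ge0 => h1.
have h2 := psd_cauchy (E *m u) u hE.
have := dotv_ge0 (E *m u); rewrite le_eqVlt => /predU1P[e0|e0].
  have e1 : dotv u (E *m u) = 0 by rewrite (dotv_eq0 (esym e0)) dotv0r.
  by rewrite -e0 e1 mulr0.
have h3 := hp u.
rewrite -(ler_pM2l e0) -expr2 (le_trans h2) // mulrA (mulrC _ beta).
exact: ler_wpM2r.
Qed.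

Lemma psd_dotv_le n (E : 'M[R]_n) (beta : R) u :
  is_psd (beta%:M - E) -> dotv u (E *m u) <= beta * dotv u u.
Proof.
by move=> [_ /(_ u)]; rewrite mulmxBl mul_scalar_mx !dotvL subr_ge0.
Qed.

Lemma mulmx_bounded m n (A : 'M[R]_(m, n)) :
  exists2 C, 0 <= C & forall u, dotv (A *m u) (A *m u) <= C * dotv u u.
Proof.
exists (\sum_i dotv (row i A)^T (row i A)^T).
  by apply: sumr_ge0 => i _; exact: dotv_ge0.
move=> u; rewrite dotvE mulr_suml; apply: ler_sum => i _.
have -> : (A *m u) i 0 = dotv (row i A)^T u.
  by rewrite mxE dotvE; apply: eq_bigr => j _; rewrite !mxE.
by rewrite -expr2 dotv_cauchy.
Qed.

(** Smallness of the seminorm [<u, H u>] thus forces smallness of [H u], although [u] may stay large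
    along the kernel. [psd_sqr_le] is applied with [C + 1], where [|H v|^2 <= C |v|^2]: since
    [C <= (C + 1)^2], this dominates the operator norm without a square root. *)
Lemma psd_mulmx_bounded n (H : 'M[R]_n) : is_psd H ->
  exists2 C, 0 <= C &
    forall u, dotv (H *m u) (H *m u) <= C * dotv u (H *m u).
Proof.
move=> hH; have [hs hp] := hH; have [C C0 hC] := mulmx_bounded H.
exists (C + 1); first by lra.
move=> u; apply: psd_sqr_le => //; split.
  by rewrite linearB /= tr_scalar_mx hs.
move=> v; rewrite mulmxBl mul_scalar_mx !dotvL subr_ge0.
have h1 := dotv_cauchy v (H *m v); have h2 := hC v; have h3 := dotv_ge0 v.
have h4 : dotv v (H *m v) ^+ 2 <= ((C + 1) * dotv v v) ^+ 2.
  rewrite (le_trans h1) // exprMn.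
  have : dotv v v * dotv (H *m v) (H *m v) <= dotv v v * (C * dotv v v).
    exact: ler_wpM2l.
  move/le_trans; apply.
  rewrite -subr_ge0; have -> : (C + 1) ^+ 2 * dotv v v ^+ 2
    - dotv v v * (C * dotv v v) = (C ^+ 2 + C + 1) * dotv v v ^+ 2 by ring.
  by rewrite mulr_ge0 ?sqr_ge0 // !addr_ge0 ?sqr_ge0.
have := hp v; move: h4; rewrite ler_sqr ?nnegrE //.
by rewrite mulr_ge0 //; lra.
Qed.

End Dot.

(** * Limits of vectors along filters *)

Section Limits.
Context {R : realType} {T : Type} {F : set_system T} {FF : ProperFilter F}.

Lemma cvg_cVP n (u : T -> 'cV[R]_n) (l : 'cV[R]_n) :
  (forall i, (fun k => u k i 0) @ F --> l i 0) -> u @ F --> l.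
Proof.
move=> h; apply/cvg_mx_entourageP => A entA.
have : \forall k \near F, forall i : 'I_n, (l i 0, u k i 0) \in A.
  apply: filter_forall => i.
  move/cvg_app_entourageP: (h i) => /(_ A entA).
  by apply: filterS => k; rewrite inE.
rewrite !near_simpl; apply: filterS => k hk i j; rewrite (ord1 j); exact: hk.
Qed.

Lemma cvg_cV n (u : T -> 'cV[R]_n) (l : 'cV[R]_n) i :
  u @ F --> l -> (fun k => u k i 0) @ F --> l i 0.
Proof.
by move=> h; apply: (@cvg_comp _ _ _ u (fun v : 'cV[R]_n => v i 0) _ _ _ h); exact: coord_continuous.
Qed.

Lemma cvg_dotv n (u v : T -> 'cV[R]_n) (a b : 'cV[R]_n) :
  u @ F --> a -> v @ F --> b ->
  (fun k => dotv (u k) (v k)) @ F --> dotv a b.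
Proof.
move=> hu hv; under eq_cvg do rewrite dotvE.
rewrite dotvE; apply: cvg_big => [|i _]; first exact: add_continuous.
by apply: cvgM; exact: cvg_cV.
Qed.

Lemma cvg_mulmx m n (A : 'M[R]_(m, n)) (u : T -> 'cV[R]_n) (l : 'cV[R]_n) :
  u @ F --> l -> (fun k => A *m u k) @ F --> A *m l.
Proof.
move=> hu; apply: cvg_cVP => i.
have E v : (A *m v) i 0 = dotv (row i A)^T v.
  by rewrite mxE dotvE; apply: eq_bigr => j _; rewrite !mxE.
under eq_cvg do rewrite E.
by rewrite E; apply: cvg_dotv => //; exact: cvg_cst.
Qed.

Lemma cvg_dotv0 n (u : T -> 'cV[R]_n) :
  (fun k => dotv (u k) (u k)) @ F --> (0 : R) -> u @ F --> (0 : 'cV[R]_n).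
Proof.
move=> h; apply: cvg_cVP => i; rewrite mxE.
have h2 : (fun k => (u k i 0) ^+ 2) @ F --> (0 : R).
  apply: (squeeze_cvgr _ (cvg_cst 0) h); apply: nearW => k.
  rewrite sqr_ge0 /= dotvE (bigD1 i) //= -expr2 lerDl.
  by apply: sumr_ge0 => j _; rewrite -expr2 sqr_ge0.
apply: norm_cvg0; rewrite -sqrtr0.
under eq_cvg do rewrite -sqrtr_sqr.
apply: (cvg_comp _ _ h2); exact: sqrt_continuous.
Qed.

Lemma cvg_dotvB n (u : T -> 'cV[R]_n) (l : 'cV[R]_n) :
  (fun k => dotv (u k - l) (u k - l)) @ F --> (0 : R) -> u @ F --> l.
Proof.
move/cvg_dotv0 => h.
have : (fun k => u k - l + l) @ F --> 0 + l by apply: cvgD => //; exact: cvg_cst.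
by under eq_cvg do rewrite subrK; rewrite add0r.
Qed.

Lemma squeeze0 (f g : T -> R) :
  (forall k, 0 <= f k <= g k) -> g @ F --> (0 : R) -> f @ F --> (0 : R).
Proof. by move=> h hg; apply: (squeeze_cvgr _ (cvg_cst 0) hg); exact: nearW. Qed.

Lemma cvg_psd0 n (H : 'M[R]_n) (u : T -> 'cV[R]_n) : is_psd H ->
  (fun k => dotv (u k) (H *m u k)) @ F --> (0 : R) -> (fun k => H *m u k) @ F --> (0 : 'cV[R]_n).
Proof.
move=> /psd_mulmx_bounded[C C0 hC] h; apply: cvg_dotv0.
apply: (@squeeze0 _ (fun k => C * dotv (u k) (H *m u k))) => [k|].
  by rewrite dotv_ge0 hC.
by rewrite -(mulr0 C); apply: cvgMr.
Qed.

End Limits.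

Lemma ultra_bounded_cvg (R : realType) (T : Type) (G : set_system T)
    (GU : UltraFilter G) n (u : T -> 'cV[R]_n) C :
  (\forall k \near G, dotv (u k) (u k) <= C) -> exists l : 'cV[R]_n, u @ G --> l.
Proof.
move=> hC.
have hi i : exists l : R, (fun k => u k i 0) @ G --> l.
  (* A coordinate with [t^2 <= C] satisfies [|t| <= C + 1], again without a square root. *)
  have := @segment_compact R (- (C + 1)) (C + 1).
  rewrite compact_ultra => /(_ ((fun k => u k i 0) @ G)).
  case.
  (* The image of an ultrafilter is maximal: for [A] in a finer filter, the preimage of [A] or that
     of its complement lies in [G], and the latter would put the empty set in [H]. *)
  - split=> [|H HF sH]; first exact: fmap_proper_filter.
    apply/seteqP; split=> // A HA.
    have [//|/= GA] := in_ultra_setVsetC ((fun k => u k i 0) @^-1` A) GU.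
    have : H (A `&` ~` A) by apply: filterI => //; exact: sH.
    by rewrite setICr => /filter_not_empty.
  - apply: filterS hC => k hk /=; rewrite in_itv /=.
    have h1 : (u k i 0) ^+ 2 <= C.
      apply: le_trans hk; rewrite dotvE (bigD1 i) //= -expr2 lerDl.
      by apply: sumr_ge0 => j _; rewrite -expr2 sqr_ge0.
    by apply/andP; split; nra.
  - by move=> l [_ hl]; exists l.
have [f hf] := choice hi.
exists (\col_i f i); apply: cvg_cVP => i; rewrite mxE; exact: hf.
Qed.

(** * Quasi-Fejer sequences *)

Section Fejer.
Context {R : realType}.

(** Since [1 + z <= exp z], the products [V k * exp (- S k)], with [S] the partial sums of [zeta],
    are eventually nonincreasing and hence converge; multiplying by the convergent [exp (S k)]
    recovers [V]. Then [delta k] is squeezed between 0 and [(1 + zeta k) * V k - V k.+1], which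
    tends to 0. *)
Lemma quasi_fejer (V delta zeta : nat -> R) :
  (forall k, 0 <= V k) -> (forall k, 0 <= delta k) -> (forall k, 0 <= zeta k) ->
  cvgn (series zeta) ->
  (\forall k \near \oo, V k.+1 + delta k <= (1 + zeta k) * V k) ->
  exists2 v : R, V @ \oo --> v & delta @ \oo --> (0 : R).
Proof.
move=> V0 d0 z0 cz hV.
pose S := series zeta.
have hS k : S k.+1 = S k + zeta k by rewrite /S seriesSr.
pose U k := V k * expR (- S k).
have U0 k : 0 <= U k by rewrite mulr_ge0 ?expR_ge0.
have hU : \forall k \near \oo, U k.+1 <= U k.
  near=> k; rewrite /U hS opprD addrC expRD mulrA ler_pM2r ?expR_gt0 //.
  rewrite expRN ler_pdivrMr ?expR_gt0 //.
  have h1 : V k.+1 + delta k <= (1 + zeta k) * V k by near: k.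
  have h2 := d0 k; have h3 : V k.+1 <= (1 + zeta k) * V k by lra.
  by rewrite (le_trans h3) // mulrC ler_wpM2l // expR_ge1Dx.
have cU : cvgn U.
  apply: (near_nonincreasing_is_cvgn (m := 0)); last exact: nearW.
  have [N _ hN] := hU; exists N => // i /= Ni j.
  elim: j => [|j IH]; first by rewrite leqn0 => /eqP ->.
  rewrite leq_eqVlt => /predU1P[->//|]; rewrite ltnS => ij.
  by rewrite (le_trans (hN j _)) ?IH //= (leq_trans Ni).
have cS : (fun k => expR (S k)) @ \oo --> expR (limn S).
  by apply: (cvg_comp _ _ cz); exact: continuous_expR.
have cV : V @ \oo --> limn U * expR (limn S).
  rewrite [V](_ : _ = fun k => U k * expR (S k)).
    exact: cvgM.
  by apply/funext => k; rewrite /U -mulrA -expRD addNr expR0 mulr1.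
exists (limn U * expR (limn S)) => //.
set v := limn U * _ in cV *.
have z00 : zeta @ \oo --> (0 : R) by exact: cvg_series_cvg_0.
have h0 : (fun k => (1 + zeta k) * V k - V k.+1) @ \oo --> (1 + 0) * v - v.
  apply: cvgB; last by rewrite cvg_shiftS.
  by apply: cvgM => //; apply: cvgD => //; exact: cvg_cst.
rewrite addr0 mul1r subrr in h0.
apply: (squeeze_cvgr _ (cvg_cst 0) h0).
by apply: filterS hV => k h; rewrite d0 /=; lra.
Unshelve. all: by end_near. Qed.

End Fejer.

(** * Suprema of affine functions and their subgradients *)

Section AffineSup.
Context {R : realType}.

(* f is the supremum of a nonempty family of affine functions *)
Definition affine_sup n (f : 'cV[R]_n -> \bar R) : Prop :=
  exists2 A : set ('cV[R]_n * R), A !=set0 &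
    forall m (rho : R), (f m <= rho%:E)%E <->
      forall a, A a -> dotv a.1 m + a.2 <= rho.

Lemma affine_sup_gtNy n (f : 'cV[R]_n -> \bar R) m :
  affine_sup f -> (-oo < f m)%E.
Proof.
move=> [A [a Aa] hA]; rewrite ltNye; apply/eqP => fm.
have /hA/(_ a Aa) : (f m <= (dotv a.1 m + a.2 - 1)%:E)%E by rewrite fm leNye.
by lra.
Qed.

Lemma affine_sup_fin n (f : 'cV[R]_n -> \bar R) m rho :
  affine_sup f -> (f m <= rho%:E)%E -> exists2 r, f m = r%:E & r <= rho.
Proof.
move=> hf; have := affine_sup_gtNy m hf.
by case: (f m) => // r _ h; exists r => //; rewrite -lee_fin.
Qed.

(** The family consists of [v |-> <v, x> - theta x] over the points where [theta] is finite:
    properness provides one, and points where [theta] is [+oo] contribute [-oo] to the supremum. *)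
Lemma affine_sup_conjugate n (theta : 'cV[R]_n -> \bar R) :
  Defs.proper theta -> affine_sup (conjugate theta).
Proof.
move=> [[x0 hx0] hNy].
exists [set a | theta a.1 = (- a.2)%:E].
  have := hNy x0; case E : (theta x0) hx0 => [r| |] // _ _.
  by exists (x0, - r); rewrite /= E opprK.
move=> v rho; split=> [h [x b] /= hx|h].
  rewrite -lee_fin; apply: le_trans h; apply: ereal_sup_ubound.
  by exists x => //=; rewrite hx -EFinB opprK (dotvC v x).
apply: ge_ereal_sup => _ [x _ <-].
have := hNy x; case E : (theta x) => [r| |] // _; last by rewrite addeNy leNye.
rewrite -EFinB lee_fin dotvC.
by apply: (h (x, - r)); rewrite /= E opprK.
Qed.

Lemma affine_sup_mulmx n p (f : 'cV[R]_p -> \bar R) (L : 'M[R]_(p, n)) :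
  affine_sup f -> affine_sup (fun m => f (L *m m)).
Proof.
move=> [A [a Aa] hA].
exists [set (L^T *m a.1, a.2) | a in A]; first by eexists; exists a.
move=> m rho; split=> [/hA h _ [b Ab <-]|h]; first by rewrite /= dotv_trl h.
by apply/hA => b Ab; rewrite -dotv_trl; apply: (h (_, _)); exists b.
Qed.

(** The family consists of sums of one member from each. For the upper bound, [b] is held fixed
    while [a] varies, which makes [f m] finite; subtracting this real number then bounds [g m]. *)
Lemma affine_sup_add n (f g : 'cV[R]_n -> \bar R) :
  affine_sup f -> affine_sup g -> affine_sup (fun m => f m + g m)%E.
Proof.
move=> hf hg; have [A [a0 Aa0] hA] := hf; have [B [b0 Bb0] hB] := hg.
exists [set c | exists a b, [/\ A a, B b & c = (a.1 + b.1, a.2 + b.2)]].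
  by exists (a0.1 + b0.1, a0.2 + b0.2), a0, b0.
move=> m rho; split=> [h _ [a [b [Aa Bb ->]]]|h] /=.
  have := affine_sup_gtNy m hf; have := affine_sup_gtNy m hg.
  case E1 : (f m) h => [r| |] //; case E2 : (g m) => [s| |] // h _ _.
  have h1 : dotv a.1 m + a.2 <= r by apply: (hA m r).1 => //; rewrite E1.
  have h2 : dotv b.1 m + b.2 <= s by apply: (hB m s).1 => //; rewrite E2.
  by move: h; rewrite -EFinD lee_fin dotvDl => h; lra.
have h1 b : B b -> (f m <= (rho - (dotv b.1 m + b.2))%:E)%E.
  move=> Bb; apply/hA => a Aa.
  have /= := h (a.1 + b.1, a.2 + b.2).
  rewrite dotvDl => h1; suff : dotv a.1 m + dotv b.1 m + (a.2 + b.2) <= rho by lra.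
  by apply: h1; exists a, b.
have [r fm _] := affine_sup_fin hf (h1 b0 Bb0).
have h2 : (g m <= (rho - r)%:E)%E.
  by apply/hB => b Bb; have := h1 b Bb; rewrite fm lee_fin => h2; lra.
have [s gm hs] := affine_sup_fin hg h2.
by rewrite fm gm -EFinD lee_fin; lra.
Qed.

Lemma affine_sup_convex n (f : 'cV[R]_n -> \bar R) x y (r s t : R) :
  affine_sup f -> f x = r%:E -> f y = s%:E -> 0 <= t <= 1 ->
  (f (x + t *: (y - x))%R <= ((1 - t) * r + t * s)%:E)%E.
Proof.
move=> [A _ hA] fx fy /andP[t0 t1]; apply/hA => a Aa.
have h1 : dotv a.1 x + a.2 <= r by apply: (hA x r).1 => //; rewrite fx.
have h2 : dotv a.1 y + a.2 <= s by apply: (hA y s).1 => //; rewrite fy.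
by rewrite !dotvL; nra.
Qed.

(** Each affine function of the family is continuous, so its inequality passes to the limit: lower
    semicontinuity along a filter, with moving levels. *)
Lemma affine_sup_closed n (f : 'cV[R]_n -> \bar R) 
    (F : set_system nat) (FF : ProperFilter F) (u : nat -> 'cV[R]_n)
    (l : 'cV[R]_n) (rho : nat -> R) (c : R) :
  affine_sup f -> u @ F --> l -> rho @ F --> c ->
  (forall k, (f (u k) <= (rho k)%:E)%E) -> (f l <= c%:E)%E.
Proof.
move=> [A _ hA] hu hrho h; apply/hA => a Aa.
have h1 : (fun k => dotv a.1 (u k) + a.2) @ F --> dotv a.1 l + a.2.
  by apply: cvgD; last exact: cvg_cst; apply: cvg_dotv => //; exact: cvg_cst.
apply: (@ler_cvg_to _ F FF _ _ _ _ _ h1 hrho).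
by apply: (@filterE _ F) => k; apply: (hA (u k) _).1.
Qed.

(* v is a subgradient at m of f + delta_U *)
Definition subgrad n (f : 'cV[R]_n -> \bar R) (U : set 'cV[R]_n) m v : Prop :=
  U m /\ exists2 r : R, f m = r%:E &
    forall y s, U y -> f y = s%:E -> r + dotv v (y - m) <= s.

Lemma subgrad_mono n (f : 'cV[R]_n -> \bar R) U m v m' v' :
  subgrad f U m v -> subgrad f U m' v' -> 0 <= dotv (v - v') (m - m').
Proof.
move=> [Um [r fm h]] [Um' [r' fm' h']].
have := h _ _ Um' fm'; have := h' _ _ Um fm; rewrite !dotvL => h1 h2; lra.
Qed.

(** Only the pairings of [v k] with [y - u k], for [y] in [U], are asked to converge, because the
    errors of the algorithm are controlled through such pairings. *)
Lemma subgrad_closed n (f : 'cV[R]_n -> \bar R) (U : set 'cV[R]_n) 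
    (F : set_system nat) (FF : ProperFilter F) (u v : nat -> 'cV[R]_n)
    (l w : 'cV[R]_n) :
  affine_sup f -> (forall k, subgrad f U (u k) (v k)) -> U l -> u @ F --> l ->
  (forall y, U y -> (fun k => dotv (v k) (y - u k)) @ F --> dotv w (y - l)) ->
  subgrad f U l w.
Proof.
move=> hf hs Ul hu hv.
have H y s : U y -> f y = s%:E -> (f l <= (s - dotv w (y - l))%:E)%E.
  move=> Uy fy.
  apply: (affine_sup_closed (rho := fun k => s - dotv (v k) (y - u k)) FF hf hu).
    by apply: cvgB; [exact: cvg_cst|exact: hv].
  move=> k; have [_ [r -> h]] := hs k.
  by have := h _ _ Uy fy; rewrite lee_fin; lra.
(* Any term of the sequence is a point of [U] where [f] is finite; testing [H] with it shows that
   [f l] is finite. *)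
have [k _] := filter_ex (@filterT _ F _).
have [Uk [r fk _]] := hs k.
have [q fl _] := affine_sup_fin hf (H _ _ Uk fk).
split=> //; exists q => // y s Uy fy.
by have := H _ _ Uy fy; rewrite fl lee_fin; lra.
Qed.

(* The smooth summand enters only through its expansion
   [t * a + t^2 * kappa] along the segment from x to y. *)
Lemma subdiff_smooth n (f : 'cV[R]_n -> \bar R) x y (r s a b kappa : R) :
  affine_sup f -> f x = r%:E -> f y = s%:E ->
  (forall t : R, 0 < t < 1 ->
    (r%:E + (t * b)%:E <=
       f (x + t *: (y - x))%R + (t * a + t ^+ 2 * kappa)%:E)%E) ->
  r + (b - a) <= s.
Proof.
move=> hf fx fy h.
have h1 (t : R) : 0 < t < 1 -> b - a - (s - r) <= t * kappa.
  move=> /andP[t0 t1]; have := h t; rewrite t0 t1 => /(_ isT).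
  have /(affine_sup_fin hf)[q -> hq] : (f (x + t *: (y - x))%R <=
      ((1 - t) * r + t * s)%:E)%E.
    by apply: affine_sup_convex => //; rewrite !ltW.
  rewrite -!EFinD lee_fin => h2.
  by rewrite -(ler_pM2l t0); lra.
suff : b - a - (s - r) <= 0 by lra.
rewrite leNgt; apply/negP; set c := b - a - (s - r) in h1 * => c0.
have k0 : 0 < kappa by have := h1 (1 / 2); lra.
(* This [t] lies in (0, 1) and satisfies [t * kappa < c], which contradicts [h1]. *)
pose t := c / (c + 2 * kappa).
have d0 : 0 < c + 2 * kappa by lra.
have t0 : 0 < t by rewrite divr_gt0.
have t1 : t < 1 by rewrite ltr_pdivrMr // mul1r; lra.
have := h1 t; rewrite t0 t1 => /(_ isT).
rewrite /t mulrAC ler_pdivlMr // -subr_ge0.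
have -> : c * kappa - c * (c + 2 * kappa) = - (c * (c + kappa)) by ring.
have : 0 < c * (c + kappa) by rewrite mulr_gt0 //; lra.
by lra.
Qed.

End AffineSup.

(** * Definiteness on subspaces and the sGS operator *)

Section PosDef.
Context {R : realType}.

Definition pos_def n (K : 'M[R]_n) : Prop :=
  K^T = K /\ forall u, u != 0 -> 0 < dotv u (K *m u).

Lemma pos_def_psd n (K : 'M[R]_n) : pos_def K -> is_psd K.
Proof.
move=> [hs hp]; split=> // u; have [->|u0] := eqVneq u 0.
  by rewrite dotv0l.
exact/ltW/hp.
Qed.

Lemma pos_def_unit n (K : 'M[R]_n) : pos_def K -> K \in unitmx.
Proof.
move=> [hs hp]; rewrite -row_free_unit -kermx_eq0.
apply/negPn/negP => /rowV0Pn[v /sub_kermxP vK v0].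
have : v^T != 0 by rewrite trmx_eq0.
by move/hp; rewrite -{1}hs -trmx_mul vK trmx0 dotv0r ltxx.
Qed.

Lemma pos_def_inv n (K : 'M[R]_n) : pos_def K -> is_psd (invmx K).
Proof.
move=> hK; have KU := pos_def_unit hK; have [hs hp] := pos_def_psd hK.
split=> [|u]; first by rewrite trmx_inv hs.
by have := hp (invmx K *m u); rewrite mulKVmx // dotvC.
Qed.

Lemma pos_def_coercive n (K : 'M[R]_n) : pos_def K ->
  exists2 C, 0 <= C & forall u, dotv u u <= C * dotv u (K *m u).
Proof.
move=> hK; have KU := pos_def_unit hK.
have [C1 C10 h1] := psd_mulmx_bounded (pos_def_psd hK).
have [C2 C20 h2] := mulmx_bounded (invmx K).
exists (C2 * C1) => [|u]; first exact: mulr_ge0.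
rewrite -{1 2}(mulKmx KU u) (le_trans (h2 _)) // -mulrA.
exact: ler_wpM2l.
Qed.

Lemma range_coercive n r (E : 'M[R]_(n, r)) M : pos_def (E^T *m M *m E) ->
  exists2 C, 0 <= C &
    forall b, dotv (E *m b) (E *m b) <= C * dotv (E *m b) (M *m (E *m b)).
Proof.
move=> /pos_def_coercive[C1 C10 h1].
have [C2 C20 h2] := mulmx_bounded E.
exists (C2 * C1) => [|b]; first exact: mulr_ge0.
rewrite (le_trans (h2 _)) // -mulrA; apply: ler_wpM2l => //.
by rewrite (le_trans (h1 _)) // -!mulmxA -dotv_mull.
Qed.

Lemma psd_inv_on n r (E : 'M[R]_(n, r)) M :
  pos_def (E^T *m M *m E) -> is_psd (inv_on E M).
Proof.
by move=> /pos_def_inv /(psd_congr E^T); rewrite trmxK.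
Qed.

(** With [K = E^T M E] the pairing equals [<K^-1 E^T d, K b>], so Cauchy-Schwarz in the metric of
    [K] applies; its first factor [<d, E K^-1 E^T d>] is [|H d|^2] because [H^2 = inv_on E M]. *)
Lemma inv_on_cauchy n r (E : 'M[R]_(n, r)) M H d b :
  pos_def (E^T *m M *m E) -> is_psd_sqrt (inv_on E M) H ->
  dotv d (E *m b) ^+ 2 <=
    enorm (H *m d) ^+ 2 * dotv (E *m b) (M *m (E *m b)).
Proof.
set K := E^T *m M *m E => hK [[Hs _] HH].
have KU := pos_def_unit hK.
have -> : dotv d (E *m b) = dotv (invmx K *m (E^T *m d)) (K *m b).
  rewrite [RHS](sym_dotv _ _ (proj1 hK)) mulKVmx //.
  by rewrite dotvC dotv_mull.
rewrite (le_trans (psd_cauchy _ _ (pos_def_psd hK))) //.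
rewrite mulKVmx // enorm_sqr [X in _ <= X * _]dotv_mull Hs mulmxA HH.
rewrite /inv_on -/K -!mulmxA [X in X * _ <= _]dotvC dotv_trl.
by rewrite -(dotv_mull E).
Qed.

(** The inequality [2 sqrt q <= 1 + q] turns the Cauchy-Schwarz bound [eps sqrt q] into an error
    linear in [eps] and relative to the squared norm, the form that summable tolerances can
    absorb. *)
Lemma inv_on_young n r (E : 'M[R]_(n, r)) M H d b eps :
  pos_def (E^T *m M *m E) -> is_psd_sqrt (inv_on E M) H ->
  enorm (H *m d) <= eps ->
  2 * dotv d (E *m b) <= eps * (1 + dotv (E *m b) (M *m (E *m b))).
Proof.
move=> hK hH he; have := inv_on_cauchy d b hK hH.
have q0 : 0 <= dotv (E *m b) (M *m (E *m b)).
  by rewrite dotv_mull !mulmxA; apply: (pos_def_psd hK).2.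
set q := dotv (E *m b) _ in q0 *; set x := dotv d _.
have e0 := enorm_ge0 (H *m d); set e := enorm _ in he e0 *.
move=> h; have : x ^+ 2 <= eps ^+ 2 * q.
  by rewrite (le_trans h) // ler_wpM2r // ler_sqr ?nnegrE // (le_trans e0).
move=> {}h; rewrite leNgt; apply/negP => h2.
have ep : 0 <= eps by lra.
have h3 : (eps * (1 + q)) ^+ 2 < (2 * x) ^+ 2.
  have h4 : 0 <= eps * (1 + q) by rewrite mulr_ge0 //; lra.
  by rewrite ltr_sqr ?nnegrE //; lra.
have := sqr_ge0 (eps * (1 - q)).
by rewrite !exprMn in h3 *; lra.
Qed.

Lemma inv_on1 n (M : 'M[R]_n) : inv_on 1%:M M = invmx M.
Proof. by rewrite /inv_on trmx1 !mul1mx !mulmx1. Qed.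

Lemma diag_upper_split n sh (H : 'M[R]_n) : H^T = H ->
  H = diag_part sh H + upper_part sh H + (upper_part sh H)^T.
Proof.
move=> hs; apply/matrixP => i j; rewrite !mxE.
have hij : H j i = H i j by rewrite -[in LHS]hs mxE.
by rewrite hij; case: ltngtP; rewrite ?add0r ?addr0.
Qed.

(* Since S is semidefinite, <e, (H + S) e> = 0 forces <e, H_u e> = 0,
   so that <e, H e> = <e, H_d e>. *)
Lemma sGS_pos_def n r (E : 'M[R]_(n, r)) sh
    (inv : 'M[R]_n -> 'M[R]_n) (H : 'M[R]_n) (U : set 'cV[R]_n) :
  (forall b : 'cV_r, U (E *m b)) -> (forall b : 'cV_r, E *m b = 0 -> b = 0) ->
  is_psd H -> pos_def_on U (diag_part sh H) ->
  inv (diag_part sh H) = inv_on E (diag_part sh H) ->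
  is_psd (sGS sh inv H) /\ pos_def (E^T *m (H + sGS sh inv H) *m E).
Proof.
move=> EU Einj Hpsd [hds hdp] hinv.
set Hd := diag_part sh H in hds hdp hinv *.
set Hu := upper_part sh H.
have hK : pos_def (E^T *m Hd *m E).
  split; first by rewrite !trmx_mul trmxK hds mulmxA.
  move=> b b0; rewrite -!mulmxA -dotv_mull; apply: hdp => //.
  by apply: contra_neq b0; exact: Einj.
have Spsd : is_psd (sGS sh inv H).
  rewrite /sGS -/Hd -/Hu hinv.
  by have := psd_congr Hu^T (psd_inv_on hK); rewrite trmxK.
split=> //.
have HS := psdD Hpsd Spsd; split; first by have [] := psd_congr E HS.
move=> b b0; rewrite -!mulmxA -dotv_mull; set e := E *m b.
rewrite lt_neqAle HS.2 andbT; apply/eqP => /esym.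
rewrite mulmxDl dotvDr => h.
have h1 := Hpsd.2 e; have h2 := Spsd.2 e.
have S0 : dotv e (sGS sh inv H *m e) = 0 by lra.
have H0 : dotv e (H *m e) = 0 by lra.
(* With [K = E^T H_d E], the vanishing quantity [<e, S e>] is the [K^-1]-form of [a], so [a = 0];
   and [<e, H_u^T e> = <b, a>]. *)
set a := E^T *m (Hu^T *m e).
have a0 : a = 0.
  set K := E^T *m Hd *m E in hK.
  have KU := pos_def_unit hK.
  have : dotv (invmx K *m a) (K *m (invmx K *m a)) = 0.
    rewrite mulKVmx // -[RHS]S0 /sGS -/Hd -/Hu hinv /inv_on -/K /a -!mulmxA.
    by rewrite dotvC !dotv_trl.
  move=> q0; apply/eqP; apply/negPn/negP => an0.
  have i0 : invmx K *m a != 0.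
    by apply: contra_neq an0 => i0; rewrite -(mulKVmx KU a) i0 mulmx0.
  by have := hK.2 _ i0; rewrite q0 ltxx.
have u0 : dotv e (Hu^T *m e) = 0.
  by rewrite {1}/e dotv_mull -/a a0 dotv0r.
have l0 : dotv e (Hu *m e) = 0 by rewrite -dotv_trl dotvC u0.
have e0 : e != 0 by apply: contra_neq b0; exact: Einj.
have := hdp e (EU b) e0.
move: H0; rewrite (diag_upper_split sh Hpsd.1) -/Hd -/Hu !mulmxDl !dotvDr u0 l0.
by rewrite !addr0 => ->; rewrite ltxx.
Qed.

End PosDef.

(** * The one-step energy inequality and its coefficients *)

Section Energy.
Context {R : realType}.
Variables (dM dN dX : nat) (Fa : 'M[R]_(dX, dM)) (Ga : 'M[R]_(dX, dN)).
Variables (Qt S : 'M[R]_dM) (T : 'M[R]_dN) (sigma alpha tau lam : R).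
Hypotheses (S_psd : is_psd S) (T_psd : is_psd T).
Hypotheses (sigma0 : 0 < sigma) (alpha01 : 0 < alpha < 1) (tau0 : 0 < tau).
Hypothesis lam0 : 0 < lam.

(* The comparison function: [xe], [me], [ne] are the distances to a KKT point,
   [dn] is the last increment of n, and [r] the last residual. *)
Definition lyap (xe : 'cV[R]_dX) (me : 'cV[R]_dM) (ne dn : 'cV[R]_dN)
    (r : 'cV[R]_dX) : R :=
  dotv xe xe / (tau * sigma) + sigma * dotv (Ga *m ne) (Ga *m ne)
  + dotv me (S *m me) + dotv ne (T *m ne)
  + sigma * (1 - alpha) * ((tau - 1) ^+ 2 / lam) * dotv r r
  + (1 - alpha) * dotv dn (T *m dn).

(** Balance of [|r|^2]: the multiplier update leaves [sigma (2 - tau)], [metric_bound] costs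
    [sigma alpha], and the last part is what [lyap] carries to the next step. In [coef_g], [lam] is
    the share of [|Ga *m Dn|^2] spent in [young_lam]. *)
Definition coef_r : R :=
  sigma * (1 - alpha - (tau - 1) - (1 - alpha) * ((tau - 1) ^+ 2 / lam)).
Definition coef_g : R := sigma * (1 - alpha) * (1 - lam).

Definition decrease (r : 'cV[R]_dX) (me Dm : 'cV[R]_dM) (Dn : 'cV[R]_dN) : R :=
  coef_r * dotv r r + coef_g * dotv (Ga *m Dn) (Ga *m Dn)
  + dotv Dm (S *m Dm) + dotv Dn (T *m Dn) + 2 * dotv me (Qt *m me).

Let sigma_neq0 : sigma != 0. Proof. exact: lt0r_neq0. Qed.

(* This is where the bound on E = P_x - Q enters. *)
Lemma metric_bound (E : 'M[R]_dX) e w :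
  is_psd E -> is_psd ((2 * alpha / sigma)%:M - E) ->
  0 <= 2 * sigma * dotv w (E *m e) + 2 * dotv e (E *m e)
       + sigma * alpha * dotv w w.
Proof.
move=> hE hB; have := psd_sqr_le e hE hB.
have /andP[a0 a1] := alpha01.
rewrite -(ler_pM2l sigma0) mulrA.
have -> : sigma * (2 * alpha / sigma) = 2 * alpha by field.
(* Completing the square: by [h1], [alpha] times the claimed expression is at least
   [sigma |E e + alpha w|^2]. *)
move=> h1; have := dotv_ge0 (E *m e + alpha *: w).
rewrite !dotvL (dotvC (E *m e) w) => h0.
rewrite -(pmulr_rge0 _ a0); have := mulr_ge0 (ltW sigma0) h0; lra.
Qed.

Lemma young_lam (x y z : R) : 0 <= (tau - 1) ^+ 2 * x
    + 2 * (tau - 1) * lam * y + lam ^+ 2 * z ->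
  - (2 * (tau - 1) * y) <= (tau - 1) ^+ 2 / lam * x + lam * z.
Proof.
move=> h; rewrite -(ler_pM2l lam0).
have -> : lam * ((tau - 1) ^+ 2 / lam * x + lam * z)
  = (tau - 1) ^+ 2 * x + lam ^+ 2 * z by field; exact: lt0r_neq0.
by lra.
Qed.

(** Doubling the first two monotonicity inequalities and applying [metric_bound] with
    [w = r - Ga *m Dn] leaves the cross term [2 sigma (1 - alpha) <r, Ga *m Dn>], of unknown sign.
    The third inequality, weighted by [2 (1 - alpha)], trades it for [- 2 sigma (1 - alpha) (tau -
    1) <r0, Ga *m Dn>], which [young_lam] splits. The resulting terms in [r0] and in the T-norm of
    [Dn0] are the last two terms of the old [lyap]. *)
Lemma energy_step (E : 'M[R]_dX) (Dm me me0 dm : 'cV[R]_dM)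
    (Dn Dn0 ne ne0 dn dn0 : 'cV[R]_dN) (r r0 xe0 xe : 'cV[R]_dX) :
  is_psd E -> is_psd ((2 * alpha / sigma)%:M - E) ->
  me = me0 + Dm -> ne = ne0 + Dn -> xe = xe0 + (tau * sigma) *: r ->
  Fa *m me + Ga *m ne = r + E *m xe0 ->
  0 <= dotv (dm - S *m Dm - Fa^T *m (sigma *: (r - Ga *m Dn) + xe0)
             - Qt *m me) me ->
  0 <= dotv (dn - T *m Dn - Ga^T *m (sigma *: r + xe0)) ne ->
  0 <= dotv ((dn - dn0) - (T *m Dn - T *m Dn0)
             - Ga^T *m (sigma *: (r + (tau - 1) *: r0))) Dn ->
  lyap xe me ne Dn r + decrease r me Dm Dn <=
    lyap xe0 me0 ne0 Dn0 r0 + 2 * dotv dm me + 2 * dotv dn ne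
    + (1 - alpha) * (2 * dotv (dn - dn0) Dn).
Proof.
move=> hE hB hme hne hxe hFG.
have em : me0 = me - Dm by rewrite hme addrK.
have en : ne0 = ne - Dn by rewrite hne addrK.
have eF : Fa *m me = r + E *m xe0 - Ga *m ne by rewrite -hFG addrK.
rewrite /lyap /decrease /coef_r /coef_g.
have hT := T_psd.2 (Dn - Dn0).
have h1 := metric_bound xe0 (r - Ga *m Dn) hE hB.
have hlam := dotv_ge0 ((tau - 1) *: r0 + lam *: (Ga *m Dn)).
have hx : dotv xe xe / (tau * sigma) = dotv xe0 xe0 / (tau * sigma)
    + 2 * dotv xe0 r + tau * sigma * dotv r r.
  rewrite hxe !dotvL (dotvC r xe0); field; rewrite sigma_neq0 /=.
  exact: lt0r_neq0.
rewrite {}em {}en {}hx {hme hne hxe hFG hE hB}.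
rewrite !(mulmxBr S, mulmxBr T, mulmxBr Ga) in hT *.
rewrite !dotvL !dotv_trl eF in hT h1 hlam *.
set g := Ga *m Dn in hT h1 hlam *; set q := Ga *m ne in hT h1 hlam *.
set w := E *m xe0 in hT h1 hlam eF *.
rewrite !dotvL in hT h1 hlam *.
rewrite ?(dotvC g r) ?(dotvC w r) ?(dotvC q r) ?(dotvC w g) ?(dotvC q g)
  ?(dotvC r xe0) ?(dotvC w xe0) ?(dotvC q xe0) ?(dotvC g r0) in hT h1 hlam *.
rewrite ?(dotvC (S *m _)) ?(dotvC (Qt *m _)) ?(dotvC (T *m _)) in hT h1 hlam *.
rewrite ?(sym_dotv Dm me S_psd.1) ?(sym_dotv Dn ne T_psd.1)
  ?(sym_dotv Dn0 Dn T_psd.1) in hT h1 hlam *.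
have {hlam} : - (2 * (tau - 1) * dotv r0 g) <=
    (tau - 1) ^+ 2 / lam * dotv r0 r0 + lam * dotv g g.
  by apply: young_lam; move: hlam; rewrite -/g; lra.
have /andP[a0 a1] := alpha01.
have b0 : 0 <= 1 - alpha by rewrite subr_ge0 ltW.
have sa : 0 <= sigma * (1 - alpha) by rewrite mulr_ge0 // ltW.
move=> /(ler_wpM2l sa) hlam hm hn /(mulr_ge0 b0) hnn.
have {}hT := mulr_ge0 b0 hT.
move: h1 hlam hT hm hn hnn {a0 a1 sa b0 eF}.
move: (dotv r r) (dotv r g) (dotv r w) (dotv r q) (dotv g g) (dotv g w)
  (dotv g q) (dotv q q) (dotv xe0 r) (dotv xe0 w) (dotv xe0 q) (dotv xe0 xe0)
  (dotv r0 r0) (dotv r0 g) (dotv dm me) (dotv dn ne) (dotv dn Dn) (dotv dn0 Dn)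
  (dotv me (S *m Dm)) (dotv Dm (S *m Dm)) (dotv me (S *m me))
  (dotv Dn (T *m Dn)) (dotv Dn (T *m Dn0)) (dotv Dn0 (T *m Dn0))
  (dotv ne (T *m Dn)) (dotv ne (T *m ne)) (dotv me (Qt *m me))
  ((tau - 1) ^+ 2 / lam) ((tau * sigma)^-1).
by move=> *; lra.
Qed.

End Energy.

(** Put [s = tau - 1] and [D = 1 - alpha - s]; the bound on [tau] gives [s^2 <= D]. Both
    coefficients are positive when [(1 - alpha) s^2 / D < lam < 1], and [lam] is the midpoint of
    this interval. It is nonempty: for [s <= 0] because [-1 < s], and for [s > 0] because
    [alpha > 0] makes [(1 - alpha) s^2 < s^2 <= D], so the largest admissible [tau] is allowed. *)
Lemma step_length_coefs (R : realType) (alpha sigma tau : R) :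
  0 < alpha < 1 -> 0 < sigma ->
  0 < tau <= (1 + Num.sqrt (5 - 4 * alpha)) / 2 ->
  exists lam, [/\ 0 < lam, 0 < coef_r sigma alpha tau lam &
                  0 < coef_g sigma alpha lam].
Proof.
move=> /andP[a0 a1] s0 /andP[t0 ht].
have u2 : Num.sqrt (5 - 4 * alpha) ^+ 2 = 5 - 4 * alpha.
  by rewrite sqr_sqrtr //; lra.
have u0 := sqrtr_ge0 (5 - 4 * alpha); set u := Num.sqrt _ in ht u2 u0.
have tau2 : tau ^+ 2 - tau <= 1 - alpha.
  suff : (2 * tau - 1) ^+ 2 <= u ^+ 2 by rewrite u2 => h; lra.
  have [h|h] := leP 0 (2 * tau - 1); first by rewrite ler_sqr ?nnegrE //; lra.
  by rewrite u2; nra.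
have [s hs] : exists s, s = tau - 1 by exists (tau - 1).
have ht' : tau = s + 1 by rewrite hs subrK.
rewrite /coef_r /coef_g -hs.
have D1 : 0 < 1 - alpha - s - (1 - alpha) * s ^+ 2.
  have [h|h] := leP s 0.
    have : s ^+ 2 < 1 by nra.
    by move=> h2; have : 0 < (1 - alpha) * (1 - s ^+ 2); [apply: mulr_gt0; lra|lra].
  have : s ^+ 2 + s <= 1 - alpha by rewrite ht' in tau2; lra.
  have : 0 < alpha * s ^+ 2 by rewrite mulr_gt0 // exprn_gt0.
  by lra.
have b0 : 0 <= (1 - alpha) * s ^+ 2 by rewrite mulr_ge0 ?sqr_ge0 // subr_ge0 ltW.
set D := 1 - alpha - s in D1 *.
have D0 : 0 < D by lra.
exists (((1 - alpha) * s ^+ 2 + D) / (2 * D)).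
have l0 : 0 < ((1 - alpha) * s ^+ 2 + D) / (2 * D) by rewrite divr_gt0 //; lra.
split=> //.
  rewrite pmulr_rgt0 // subr_gt0 mulrA ltr_pdivrMr //.
  have -> : D * (((1 - alpha) * s ^+ 2 + D) / (2 * D)) =
    ((1 - alpha) * s ^+ 2 + D) / 2 by field; exact: lt0r_neq0.
  by lra.
rewrite pmulr_rgt0; last by rewrite mulr_gt0 // subr_gt0.
by rewrite subr_gt0 ltr_pdivrMr; lra.
Qed.

Section MatrixEntries.
Context {R : realType} {p q : nat}.
Implicit Types A B : 'M[R]_(p, q).

Lemma mxDE A B i j : (A + B) i j = A i j + B i j. Proof. by rewrite mxE. Qed.
Lemma mxNE A i j : (- A) i j = - A i j. Proof. by rewrite mxE. Qed.
Lemma mxZE (a : R) A i j : (a *: A) i j = a * A i j. Proof. by rewrite mxE. Qed.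

End MatrixEntries.

(* Equalities between linear combinations of column vectors; matrix products
   are distributed first and their entries then treated as atoms. *)
Ltac vring :=
  rewrite ?(mulmxBr, mulmxDr, mulmxN, =^~ scalemxAr);
  apply/matrixP => ? ?; rewrite ?(mxDE, mxNE, mxZE); ring.

Lemma cvg_series_pairs (R : realType) (e : nat -> R) (a : R) :
  cvgn (series e) -> cvgn (series (fun k => a * (e k.+1 + e k))).
Proof.
move=> ce.
have -> : series (fun k => a * (e k.+1 + e k)) =
    (fun k => a * (series e k.+1 - e 0%N + series e k)).
  apply/funext; elim=> [|k IH].
    by rewrite seriesSr /series /= !big_geq // add0r subrr addr0 mulr0.
  by rewrite seriesSr IH !seriesSr; ring.
apply/cvg_ex; exists (a * (limn (series e) - e 0%N + limn (series e))).
apply: cvgMr; apply: cvgD => //; apply: cvgB; last exact: cvg_cst.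
by rewrite cvg_shiftS.
Qed.

Ltac nonneg := repeat first
  [ assumption | by apply: ltW | exact: dotv_ge0 | exact: sqr_ge0
  | apply: mulr_ge0 | apply: addr_ge0 | rewrite invr_ge0 | exact: ler0n ].

(** * Convergence of the abstract two-block iteration *)

Section Convergence.
Context {R : realType}.
Variables (dM dN dX : nat) (Fa : 'M[R]_(dX, dM)) (Ga : 'M[R]_(dX, dN)).
Variables (Qt S : 'M[R]_dM) (T : 'M[R]_dN) (sigma alpha tau lam : R).
Variables (P : 'cV[R]_dM -> \bar R) (q : 'cV[R]_dN -> \bar R).
Variables (U : set 'cV[R]_dM) (bb : 'cV[R]_dN) (c : 'cV[R]_dX -> 'cV[R]_dX).
Variables (eps : nat -> R) (m dm : nat -> 'cV[R]_dM) (n dn : nat -> 'cV[R]_dN).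
Variable x : nat -> 'cV[R]_dX.
Hypotheses (Qt_psd : is_psd Qt) (S_psd : is_psd S) (T_psd : is_psd T).
Hypotheses (sigma0 : 0 < sigma) (alpha01 : 0 < alpha < 1) (tau0 : 0 < tau).
Hypotheses (lam0 : 0 < lam) (cr0 : 0 < coef_r sigma alpha tau lam)
  (cg0 : 0 < coef_g sigma alpha lam).
Hypotheses (P_sup : affine_sup P) (q_sup : affine_sup q).
Hypothesis U_sub : forall a b, U a -> U b -> U (a - b).
Hypothesis eps0 : forall k, 0 <= eps k.
Hypothesis eps_sum : cvgn (series eps).

(** In the application [normM] and [normN] are the quadratic forms of [Mop] and [Nop], written out
    so that their parts can be bounded separately. *)
Definition normM (e : 'cV[R]_dM) : R :=
  dotv e (Qt *m e) + sigma * dotv (Fa *m e) (Fa *m e) + dotv e (S *m e).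
Definition normN (e : 'cV[R]_dN) : R :=
  sigma * dotv (Ga *m e) (Ga *m e) + dotv e (T *m e).

Hypothesis dm_small : forall k e, U e -> 2 * dotv (dm k) e <= eps k * (1 + normM e).
Hypothesis dn_small : forall k e, 2 * dotv (dn k) e <= eps k * (1 + normN e).

Definition residual k : 'cV[R]_dX := Fa *m m k.+1 + Ga *m n k.+1 - c (x k).

Hypothesis M_coercive : exists2 C, 0 <= C &
  forall e, U e -> dotv e e <= C * normM e.
Hypothesis N_coercive : exists2 C, 0 <= C &
  forall e, dotv e e <= C * normN e.

Hypothesis m_step : forall k, subgrad P U (m k.+1)
  (dm k - S *m (m k.+1 - m k)
   - Fa^T *m (sigma *: (Fa *m m k.+1 + Ga *m n k - c (x k)) + x k)
   - Qt *m m k.+1).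
Hypothesis n_step : forall k, subgrad q setT (n k.+1)
  (dn k - T *m (n k.+1 - n k) - Ga^T *m (sigma *: residual k + x k) + bb).
Hypothesis x_step : forall k, x k.+1 = x k + (tau * sigma) *: residual k.

(** The KKT system with the gradients of the quadratic and linear terms moved to the right and the
    constraint on [w] kept in [U]: this form is directly comparable with [m_step] and [n_step]. *)
Definition kkt_pt mb nb xb : Prop :=
  [/\ subgrad P U mb (- (Fa^T *m xb) - Qt *m mb),
      subgrad q setT nb (- (Ga^T *m xb) + bb) &
      Fa *m mb + Ga *m nb = c xb].

Hypothesis c_metric : forall mb nb xb k, kkt_pt mb nb xb ->
  exists E, [/\ is_psd E, is_psd ((2 * alpha / sigma)%:M - E) &
                c (x k) - c xb = E *m (x k - xb)].

Let U_m k : U (m k.+1). Proof. by have [] := m_step k. Qed.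

Let a0 : 0 < alpha. Proof. by have /andP[] := alpha01. Qed.
Let a1 : 0 < 1 - alpha. Proof. by have /andP[] := alpha01; lra. Qed.
Let ts0 : 0 < tau * sigma. Proof. exact: mulr_gt0. Qed.

Local Notation lyapf := (lyap Ga S T sigma alpha tau lam).
Local Notation decf := (decrease Ga Qt S T sigma alpha tau lam).
Local Notation cr := (coef_r sigma alpha tau lam).
Local Notation cg := (coef_g sigma alpha lam).

Let kap0 : 0 <= (tau - 1) ^+ 2 / lam.
Proof. by rewrite divr_ge0 ?sqr_ge0 // ltW. Qed.

Lemma lyap_terms xe me ne d r :
  [/\ 0 <= lyapf xe me ne d r, dotv xe xe <= tau * sigma * lyapf xe me ne d r,
      normN ne <= lyapf xe me ne d r & dotv me (S *m me) <= lyapf xe me ne d r].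
Proof.
rewrite /lyap /normN.
have h1 : 0 <= dotv xe xe / (tau * sigma) by nonneg.
have h2 : 0 <= sigma * dotv (Ga *m ne) (Ga *m ne).
  by nonneg.
have h3 := S_psd.2 me; have h4 := T_psd.2 ne.
have h5 : 0 <= sigma * (1 - alpha) * ((tau - 1) ^+ 2 / lam) * dotv r r.
  by nonneg.
have h6 : 0 <= (1 - alpha) * dotv d (T *m d).
  by apply: mulr_ge0; [exact: ltW|exact: T_psd.2].
split; [lra| |lra|lra].
rewrite mulrC -ler_pdivrMr //; lra.
Qed.

Lemma decrease_terms r me Dm Dn :
  [/\ 0 <= decf r me Dm Dn, cr * dotv r r <= decf r me Dm Dn,
      cg * dotv (Ga *m Dn) (Ga *m Dn) <= decf r me Dm Dn,
      dotv Dm (S *m Dm) <= decf r me Dm Dn &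
      dotv Dn (T *m Dn) <= decf r me Dm Dn] /\
  2 * dotv me (Qt *m me) <= decf r me Dm Dn.
Proof.
rewrite /decrease.
have h1 : 0 <= cr * dotv r r by nonneg.
have h2 : 0 <= cg * dotv (Ga *m Dn) (Ga *m Dn).
  by nonneg.
have h3 := S_psd.2 Dm; have h4 := T_psd.2 Dn; have h5 := Qt_psd.2 me.
by do !split; lra.
Qed.

Section FixedPoint.
Variables (mb : 'cV[R]_dM) (nb : 'cV[R]_dN) (xb : 'cV[R]_dX).
Hypothesis kkt : kkt_pt mb nb xb.

(** Index [k] refers to iterate [k + 1]: a last increment and a last residual must exist, and
    comparing consecutive n-inclusions requires that both come from the algorithm. *)
Definition W k : R := lyapf (x k.+1 - xb) (m k.+1 - mb) (n k.+1 - nb)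
  (n k.+1 - n k) (residual k).
Definition decr k : R := decf (residual k.+1) (m k.+2 - mb)
  (m k.+2 - m k.+1) (n k.+2 - n k.+1).

Lemma energy_iter k : W k.+1 + decr k <= W k
  + 2 * dotv (dm k.+1) (m k.+2 - mb) + 2 * dotv (dn k.+1) (n k.+2 - nb)
  + (1 - alpha) * (2 * dotv (dn k.+1 - dn k) (n k.+2 - n k.+1)).
Proof.
have [E [hE hB hc]] := c_metric k.+1 kkt; have [kM kN kc] := kkt.
apply: (energy_step S_psd T_psd sigma0 alpha01 tau0 lam0 hE hB).
- by vring.
- by vring.
- by rewrite x_step; vring.
- by rewrite -hc -kc /residual; vring.
- have := subgrad_mono (m_step k.+1) kM; congr (_ <= dotv _ _).
  by rewrite /residual; vring.
- have := subgrad_mono (n_step k.+1) kN; congr (_ <= dotv _ _); vring.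
- have := subgrad_mono (n_step k.+1) (n_step k); congr (_ <= dotv _ _).
  by rewrite x_step; vring.
Qed.

Let beta := 2 * alpha / sigma.

(** The identity [Fa *m me = (r - Ga *m ne) + E *m xe] is squared with two uses of
    [|a + b|^2 <= 2 |a|^2 + 2 |b|^2]. The decrease bounds [r], [W k.+1] bounds [Ga *m ne], and [W k]
    bounds [E *m xe] since [E] is at most [beta]; hence two consecutive values of [W]. *)
Lemma normM_bound : exists2 C, 0 <= C & forall k,
  normM (m k.+2 - mb) <= C * (W k + W k.+1 + decr k).
Proof.
exists (5 + 4 * sigma / cr + 2 * sigma * (beta ^+ 2 * (tau * sigma))).
  have : 0 <= 4 * sigma / cr by nonneg.
  have : 0 <= 2 * sigma * (beta ^+ 2 * (tau * sigma)).
    by nonneg.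
  by lra.
move=> k; have [E [hE hB hc]] := c_metric k.+1 kkt; have [_ _ kc] := kkt.
have [W0 Wx _ _] := lyap_terms (x k.+1 - xb) (m k.+1 - mb) (n k.+1 - nb)
  (n k.+1 - n k) (residual k).
have [W0' _ WN' WS'] := lyap_terms (x k.+2 - xb) (m k.+2 - mb) (n k.+2 - nb)
  (n k.+2 - n k.+1) (residual k.+1).
have [[D0 Dr _ _ _] DQ] := decrease_terms (residual k.+1) (m k.+2 - mb)
  (m k.+2 - m k.+1) (n k.+2 - n k.+1).
rewrite -/(W k) in W0 Wx; rewrite -/(W k.+1) in W0' WN' WS'.
rewrite -/(decr k) in D0 Dr DQ.
set me := m k.+2 - mb in WS' DQ *; set ne := n k.+2 - nb in WN' *.
set xe := x k.+1 - xb in Wx *; set r := residual k.+1 in Dr *.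
have eF : Fa *m me = (r - Ga *m ne) + E *m xe.
  by rewrite -hc -kc /r /residual /me /ne; vring.
have h1 : dotv (E *m xe) (E *m xe) <= beta ^+ 2 * (tau * sigma * W k).
  have h := psd_sqr_le xe hE hB; rewrite -/beta in h hB.
  apply: (le_trans h); rewrite expr2 -mulrA.
  have b0 : 0 <= beta by rewrite /beta; nonneg.
  apply: ler_wpM2l => //.
  by rewrite (le_trans (psd_dotv_le xe hB)) // ler_wpM2l.
have h2 := dotv_normD (r - Ga *m ne) (E *m xe).
have h3 := dotv_normD r (- (Ga *m ne)).
rewrite !(dotvNl, dotvNr) opprK in h3.
have h4 : dotv (Fa *m me) (Fa *m me) <= 4 * dotv r r
    + 4 * dotv (Ga *m ne) (Ga *m ne) + 2 * (beta ^+ 2 * (tau * sigma * W k)).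
  by rewrite eF; lra.
have h5 : sigma * dotv r r <= sigma / cr * decr k.
  by rewrite mulrAC -[X in _ <= X]mulrA ler_pM2l // ler_pdivlMr // mulrC.
have h6 := T_psd.2 ne.
have := ler_wpM2l (ltW sigma0) h4.
have q1 : 0 <= sigma / cr by nonneg.
have q2 : 0 <= sigma * (beta ^+ 2 * (tau * sigma)).
  by nonneg.
have q3 : 0 <= sigma / cr * (W k + W k.+1) by rewrite mulr_ge0 //; lra.
have q4 : 0 <= sigma * (beta ^+ 2 * (tau * sigma)) * (W k.+1 + decr k).
  by rewrite mulr_ge0 //; lra.
rewrite /normM /normN in WN' *.
move: (dotv me _) (dotv me _) (dotv (Fa *m me) _) (dotv r r)
  (dotv (Ga *m ne) _) (dotv ne _) WS' DQ WN' h5 h6 q3 q4 W0 W0' D0 {h1 h2 h3 h4 Wx Dr eF}.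
rewrite -(mulrA 4).
move: (W k) (W k.+1) (decr k) (sigma / cr) (beta ^+ 2) => w w' dd sc b2.
by move=> *; lra.
Qed.

Lemma normN_bound : exists2 C, 0 <= C & forall k,
  normN (n k.+2 - n k.+1) <= C * decr k.
Proof.
exists (sigma / cg + 1); first by rewrite addr_ge0 // divr_ge0 // ltW.
move=> k; have [[D0 _ Dg _ DT] _] := decrease_terms (residual k.+1) (m k.+2 - mb)
  (m k.+2 - m k.+1) (n k.+2 - n k.+1).
rewrite -/(decr k) in D0 Dg DT; rewrite /normN mulrDl mul1r lerD //.
by rewrite mulrAC -[X in _ <= X]mulrA ler_pM2l // ler_pdivlMr // mulrC.
Qed.

Lemma quasi_decrease : exists2 C, 0 <= C & forall k,
  W k.+1 + decr k <= W k + C * (eps k.+1 + eps k) * (1 + W k + W k.+1 + decr k).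
Proof.
have [C1 C10 h1] := normM_bound; have [C2 C20 h2] := normN_bound.
exists (4 + C1 + C2); first by lra.
move=> k; have := energy_iter k; move: (h1 k) (h2 k) => {}h1 {}h2.
have W0 : 0 <= W k by have [] := lyap_terms (x k.+1 - xb) (m k.+1 - mb)
  (n k.+1 - nb) (n k.+1 - n k) (residual k).
have [W0' _ WN' _] := lyap_terms (x k.+2 - xb) (m k.+2 - mb) (n k.+2 - nb)
  (n k.+2 - n k.+1) (residual k.+1).
rewrite -/(W k.+1) in W0' WN'.
have D0 : 0 <= decr k by have [[]] := decrease_terms (residual k.+1)
  (m k.+2 - mb) (m k.+2 - m k.+1) (n k.+2 - n k.+1).
have Ume : U (m k.+2 - mb) by apply: U_sub => //; have [[]] := kkt.
have e1 := dm_small k.+1 Ume.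
have e2 := dn_small k.+1 (n k.+2 - nb).
have e3 := dn_small k.+1 (n k.+2 - n k.+1).
(* [dn k] enters with a minus sign, so its bound is applied to the opposite increment. *)
have e4 := dn_small k (- (n k.+2 - n k.+1)).
have nn : normN (- (n k.+2 - n k.+1)) = normN (n k.+2 - n k.+1).
  by rewrite /normN !mulmxN !(dotvNl, dotvNr) !opprK.
rewrite nn dotvNr in e4; rewrite dotvDl dotvNl.
have p1 := eps0 k.+1; have p0 := eps0 k.
set X := W k + W k.+1 + decr k in h1.
have X0 : 0 <= X by rewrite /X; lra.
have f1 : eps k.+1 * (1 + normM (m k.+2 - mb)) <= eps k.+1 * (1 + C1 * X).
  by rewrite ler_wpM2l // lerD2l.
have f2 : eps k.+1 * (1 + normN (n k.+2 - nb)) <= eps k.+1 * (1 + X).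
  by rewrite ler_wpM2l // lerD2l /X; lra.
have h3 : C2 * decr k <= C2 * X by rewrite ler_wpM2l // /X; lra.
have f3 : eps k.+1 * (1 + normN (n k.+2 - n k.+1)) <= eps k.+1 * (1 + C2 * X).
  by rewrite ler_wpM2l // lerD2l; lra.
have f4 : eps k * (1 + normN (n k.+2 - n k.+1)) <= eps k * (1 + C2 * X).
  by rewrite ler_wpM2l // lerD2l; lra.
have g : (1 - alpha) * (2 * (dotv (dn k.+1) (n k.+2 - n k.+1)
    - dotv (dn k) (n k.+2 - n k.+1))) <= (eps k.+1 + eps k) * (1 + C2 * X).
  have B0 : 0 <= (eps k.+1 + eps k) * (1 + C2 * X).
    by rewrite mulr_ge0 ?addr_ge0 // mulr_ge0.
  have : 2 * (dotv (dn k.+1) (n k.+2 - n k.+1) - dotv (dn k) (n k.+2 - n k.+1))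
    <= (eps k.+1 + eps k) * (1 + C2 * X) by lra.
  move=> /(ler_wpM2l (ltW a1)) /le_trans; apply.
  by apply: ler_piMl => //; rewrite gerBl ltW.
have p2 : 0 <= eps k * (1 + X) * (3 + C1) by rewrite !mulr_ge0 //; lra.
have p3 : 0 <= eps k.+1 * X by rewrite mulr_ge0.
have p4 : 0 <= eps k * (C2 + X) by rewrite mulr_ge0 //; lra.
have p5 : 0 <= eps k.+1 * C1 by rewrite mulr_ge0.
have p6 : 0 <= eps k.+1 * C2 by rewrite mulr_ge0.
have p7 : 0 <= eps k * (C1 * X) by rewrite !mulr_ge0.
have -> : 1 + W k + W k.+1 + decr k = 1 + X by rewrite /X; ring.
move=> h; apply: (le_trans h).
by lra.
Qed.

Lemma fejer_cvg : exists2 v : R, W @ \oo --> v & decr @ \oo --> (0 : R).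
Proof.
have [C C0 hC] := quasi_decrease.
(* The factor 4 leaves room for absorption: [1 + z / 4 <= (1 - z / 4) * (1 + z)] for [0 <= z <= 1],
   so the error terms in [W k.+1] and [decr k] can be moved to the left. The additive constant of
   the error is absorbed by working with [1 + W]. *)
pose zeta k := 4 * C * (eps k.+1 + eps k).
have W0 k : 0 <= W k by have [] := lyap_terms (x k.+1 - xb) (m k.+1 - mb)
  (n k.+1 - nb) (n k.+1 - n k) (residual k).
have D0 k : 0 <= decr k by have [[]] := decrease_terms (residual k.+1)
  (m k.+2 - mb) (m k.+2 - m k.+1) (n k.+2 - n k.+1).
have cz : cvgn (series zeta) by exact: cvg_series_pairs.
have z0 : zeta @ \oo --> (0 : R) by exact: cvg_series_cvg_0.
have zn k : 0 <= zeta k by rewrite /zeta !mulr_ge0 // addr_ge0.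
have V0 k : 0 <= 1 + W k by rewrite addr_ge0.
have Vdec : \forall k \near \oo,
    1 + W k.+1 + decr k <= (1 + zeta k) * (1 + W k).
  near=> k; have z1 : zeta k < 1 by near: k; exact: (cvgr_lt _ z0).
  have := hC k; have -> : C * (eps k.+1 + eps k) = zeta k / 4.
    by rewrite /zeta; field.
  have := zn k; have := W0 k; have := W0 k.+1; have := D0 k.
  move: z1; move: (zeta k) (W k) (W k.+1) (decr k) => z w w' d z1 d0 w0' w0 zp h.
  have p : 0 < 1 - z / 4 by lra.
  rewrite -(ler_pM2l p).
  have : 0 <= z * (1 - z) * (1 + w) by rewrite !mulr_ge0 //; lra.
  have : 0 <= z * (1 + w) by rewrite mulr_ge0 //; lra.
  by lra.
have [v hv hd] := quasi_fejer V0 D0 zn cz Vdec.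
exists (v - 1) => //.
have : (fun k => 1 + W k - 1) @ \oo --> v - 1 by apply: cvgB => //; exact: cvg_cst.
by under eq_cvg do rewrite addrAC subrr add0r.
Unshelve. all: by end_near. Qed.

Lemma residual_cvg0 : (fun k => residual k.+1) @ \oo --> (0 : 'cV[R]_dX).
Proof.
have [v _ hd] := fejer_cvg; apply: cvg_dotv0.
apply: (@squeeze0 _ _ _ _ _ (fun k => decr k * cr^-1)) => [k|].
  rewrite dotv_ge0 ler_pdivlMr //= mulrC.
  by have [[]] := decrease_terms (residual k.+1) (m k.+2 - mb)
    (m k.+2 - m k.+1) (n k.+2 - n k.+1).
by rewrite -(mul0r cr^-1); apply: cvgMl.
Qed.

(** [S] is only semidefinite, so the increments of [m] themselves are not claimed to vanish; the
    m-inclusion contains them only through [S]. *)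
Lemma incr_m_cvg0 :
  (fun k => S *m (m k.+2 - m k.+1)) @ \oo --> (0 : 'cV[R]_dM).
Proof.
have [v _ hd] := fejer_cvg; apply: (cvg_psd0 S_psd).
apply: (squeeze0 _ hd) => k; rewrite S_psd.2 /=.
by have [[]] := decrease_terms (residual k.+1) (m k.+2 - mb)
  (m k.+2 - m k.+1) (n k.+2 - n k.+1).
Qed.

Lemma incr_n_cvg0 : (fun k => n k.+2 - n k.+1) @ \oo --> (0 : 'cV[R]_dN).
Proof.
have [v _ hd] := fejer_cvg; have [C C0 hC] := normN_bound.
have [CN CN0 hCN] := N_coercive; apply: cvg_dotv0.
apply: (@squeeze0 _ _ _ _ _ (fun k => CN * (C * decr k))) => [k|].
  by rewrite dotv_ge0 /= (le_trans (hCN _)) // ler_wpM2l.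
by rewrite -(mulr0 CN) -(mulr0 C); do 2 apply: cvgMr.
Qed.

Lemma distance_bound : exists2 C, 0 <= C & forall k,
  [/\ dotv (m k.+2 - mb) (m k.+2 - mb) <= C * (W k + W k.+1 + decr k),
      dotv (n k.+2 - nb) (n k.+2 - nb) <= C * (W k + W k.+1 + decr k) &
      dotv (x k.+1 - xb) (x k.+1 - xb) <= C * (W k + W k.+1 + decr k)].
Proof.
have [C C0 hC] := normM_bound; have [CM CM0 hCM] := M_coercive.
have [CN CN0 hCN] := N_coercive.
exists (CM * C + CN + tau * sigma); first by nonneg.
move=> k; have [W0 Wx _ _] := lyap_terms (x k.+1 - xb) (m k.+1 - mb)
  (n k.+1 - nb) (n k.+1 - n k) (residual k).
have [W0' _ WN' _] := lyap_terms (x k.+2 - xb) (m k.+2 - mb) (n k.+2 - nb)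
  (n k.+2 - n k.+1) (residual k.+1).
have [[D0 _ _ _ _] _] := decrease_terms (residual k.+1) (m k.+2 - mb)
  (m k.+2 - m k.+1) (n k.+2 - n k.+1).
rewrite -/(W k) in W0 Wx; rewrite -/(W k.+1) in W0' WN'.
rewrite -/(decr k) in D0.
have Ume : U (m k.+2 - mb) by apply: U_sub => //; have [[]] := kkt.
have hm := le_trans (hCM _ Ume) (ler_wpM2l CM0 (hC k)).
have hn := le_trans (hCN (n k.+2 - nb)) (ler_wpM2l CN0 WN').
set X := W k + W k.+1 + decr k in hm *.
have X0 : 0 <= X by rewrite /X; lra.
have p1 : 0 <= CM * C * X by nonneg.
have p2 : 0 <= CN * X by nonneg.
have p3 : 0 <= tau * sigma * X by nonneg.
have p4 : CN * W k.+1 <= CN * X by rewrite ler_wpM2l // /X; lra.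
have p5 : tau * sigma * W k <= tau * sigma * X.
  by apply: ler_wpM2l; [exact: ltW|rewrite /X; lra].
rewrite mulrA in hm.
by split; lra.
Qed.

Lemma distance_cvg v : W @ \oo --> v ->
  (fun k => W k + W k.+1 + decr k) @ \oo --> v + v + 0.
Proof.
move=> hv; have [w _ hd] := fejer_cvg; apply: cvgD => //; apply: cvgD => //.
by rewrite cvg_shiftS.
Qed.

Lemma cvg_of_W0 : W @ \oo --> (0 : R) ->
  [/\ m @ \oo --> mb, n @ \oo --> nb & x @ \oo --> xb].
Proof.
move=> /distance_cvg; rewrite !addr0 => hX; have [C C0 hC] := distance_bound.
have hCX : (fun k => C * (W k + W k.+1 + decr k)) @ \oo --> (0 : R).
  by rewrite -(mulr0 C); apply: cvgMr.
split.
- rewrite -(cvg_shiftn 2); apply: cvg_dotvB; apply: (squeeze0 _ hCX) => k.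
  by rewrite /= addn2 dotv_ge0; have [] := hC k.
- rewrite -(cvg_shiftn 2); apply: cvg_dotvB; apply: (squeeze0 _ hCX) => k.
  by rewrite /= addn2 dotv_ge0; have [] := hC k.
- rewrite -(cvg_shiftn 1); apply: cvg_dotvB; apply: (squeeze0 _ hCX) => k.
  by rewrite /= addn1 dotv_ge0; have [] := hC k.
Qed.

End FixedPoint.

Hypothesis U_closed : forall (F : set_system nat) (u : nat -> 'cV[R]_dM)
  (l : 'cV[R]_dM), ProperFilter F -> (forall k, U (u k)) -> u @ F --> l -> U l.
Hypothesis c_cont : forall (F : set_system nat) (u : nat -> 'cV[R]_dX)
  (l : 'cV[R]_dX), ProperFilter F -> u @ F --> l ->
  (fun k => c (u k)) @ F --> c l.

Let cvg_G (T' : topologicalType) (G : set_system nat) (u : nat -> T') (l : T') :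
  \oo `<=` G -> u @ \oo --> l -> u @ G --> l.
Proof. by move=> sG h A /h; exact: sG. Qed.

Let cvg_perturb_dotv (G : set_system nat) (GP : ProperFilter G) dim
    (f g : nat -> R) (u w : nat -> 'cV[R]_dim) (a b : 'cV[R]_dim) :
  f @ G --> (0 : R) -> u @ G --> a -> w @ G --> b ->
  (forall k, f k + dotv (u k) (w k) = g k) -> g @ G --> dotv a b.
Proof.
move=> hf hu hw /funext <-; rewrite -[dotv a b]add0r.
by apply: cvgD => //; exact: cvg_dotv.
Qed.

(** The staggered indices are those of one step: the inclusions at [m k.+2] and [n k.+2] are formed
    with [x k.+1]. *)
Lemma cluster_kkt mb nb xb (G : set_system nat) ml nl xl :
  kkt_pt mb nb xb -> ProperFilter G -> \oo `<=` G ->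
  (fun k => m k.+2) @ G --> ml -> (fun k => n k.+2) @ G --> nl ->
  (fun k => x k.+1) @ G --> xl -> kkt_pt ml nl xl.
Proof.
move=> kkt GP sG hm hn hx.
have r0 := cvg_G sG (residual_cvg0 kkt).
have S0 := cvg_G sG (incr_m_cvg0 kkt).
have N0 := cvg_G sG (incr_n_cvg0 kkt).
have eps0' : (fun k => eps k.+1) @ G --> (0 : R).
  apply: (cvg_G sG); rewrite (cvg_shiftS eps); exact: cvg_series_cvg_0.
have hF : Fa *m ml + Ga *m nl = c xl.
  have h : (fun k => residual k.+1) @ G --> Fa *m ml + Ga *m nl - c xl.
    by apply: cvgB; [apply: cvgD; exact: cvg_mulmx|exact: c_cont].
  have /eqP : Fa *m ml + Ga *m nl - c xl = 0.
    exact: (cvg_unique (@norm_hausdorff _ _) h r0).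
  by rewrite subr_eq0 => /eqP.
(* The m-step uses the old [n], so its multiplier differs from that of the n-step by the image of an
   increment of [n], which vanishes. *)
have hs : (fun k => sigma *: (residual k.+1 - Ga *m (n k.+2 - n k.+1)) + x k.+1)
    @ G --> xl.
  have : (fun k => sigma *: (residual k.+1 - Ga *m (n k.+2 - n k.+1)) + x k.+1)
    @ G --> sigma *: (0 - Ga *m 0) + xl.
    apply: cvgD => //; apply: cvgZr; apply: cvgB => //; exact: cvg_mulmx.
  by rewrite mulmx0 subrr scaler0 add0r.
(* Testing with [e] and [- e] bounds the absolute value of the pairing; the factor [1 + N (y - u k)]
   converges while [eps] tends to 0. *)
have small (dim : nat) (dd u : nat -> 'cV[R]_dim) (N : 'cV[R]_dim -> R)
    (y l : 'cV[R]_dim) (V : set 'cV[R]_dim) :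
    (forall k e, V e -> 2 * dotv (dd k) e <= eps k * (1 + N e)) ->
    (forall e, N (- e) = N e) -> (forall k, V (y - u k)) -> (forall k, V (u k - y)) ->
    (fun k => N (y - u k)) @ G --> N (y - l) ->
    (fun k => dotv (dd k.+1) (y - u k)) @ G --> (0 : R).
  move=> hsm hN V1 V2 hc; apply: norm_cvg0.
  apply: (@squeeze0 _ _ _ _ _ (fun k => eps k.+1 * (1 + N (y - u k)) / 2)) => [k|].
    rewrite normr_ge0 ler_norml /=.
    have e1 := hsm k.+1 _ (V1 k); have e2 := hsm k.+1 _ (V2 k).
    rewrite -opprB hN dotvNr in e2.
    by apply/andP; split; lra.
  have -> : 0 = 0 * (1 + N (y - l)) / 2 :> R by rewrite !mul0r.
  by apply: cvgMl; apply: cvgM => //; apply: cvgD => //; exact: cvg_cst.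
have cN (dim : nat) (H : 'M[R]_dim) (u : nat -> 'cV[R]_dim) (l : 'cV[R]_dim) :
    u @ G --> l -> (fun k => dotv (u k) (H *m u k)) @ G --> dotv l (H *m l).
  by move=> h; apply: cvg_dotv => //; exact: cvg_mulmx.
have cG (dim : nat) (H : 'M[R]_(dX, dim)) (u : nat -> 'cV[R]_dim)
    (l : 'cV[R]_dim) : u @ G --> l ->
    (fun k => sigma * dotv (H *m u k) (H *m u k)) @ G -->
      sigma * dotv (H *m l) (H *m l).
  by move=> h; apply: cvgMr; apply: cvg_dotv; exact: cvg_mulmx.
split=> //.
- have Uml : U ml by apply: (U_closed GP _ hm).
  apply: (@subgrad_closed _ _ P U G GP (fun k => m k.+2)
    (fun k => dm k.+1 - S *m (m k.+2 - m k.+1) - Fa^T *m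
      (sigma *: (Fa *m m k.+2 + Ga *m n k.+1 - c (x k.+1)) + x k.+1)
      - Qt *m m k.+2)) => // y Uy.
  have hy : (fun k => y - m k.+2) @ G --> y - ml.
    by apply: cvgB => //; exact: cvg_cst.
  have h1 : (fun k => dotv (dm k.+1) (y - m k.+2)) @ G --> (0 : R).
    apply: (small _ _ _ normM y ml U) => //.
    - by move=> e; rewrite /normM !mulmxN !(dotvNl, dotvNr) !opprK.
    - by move=> k; exact: U_sub.
    - by move=> k; exact: U_sub.
    - by apply: cvgD; [apply: cvgD|]; [exact: cN|exact: cG|exact: cN].
  have h2 : (fun k => - (S *m (m k.+2 - m k.+1))
      - Fa^T *m (sigma *: (residual k.+1 - Ga *m (n k.+2 - n k.+1)) + x k.+1)
      - Qt *m m k.+2) @ G --> - 0 - Fa^T *m xl - Qt *m ml.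
    apply: cvgB; last exact: cvg_mulmx.
    by apply: cvgB; [exact: cvgN|exact: cvg_mulmx].
  rewrite oppr0 add0r in h2; apply: (cvg_perturb_dotv GP h1 h2 hy) => k.
  by rewrite -dotvDl; congr dotv; rewrite /residual; vring.
- apply: (@subgrad_closed _ _ q setT G GP (fun k => n k.+2)
    (fun k => dn k.+1 - T *m (n k.+2 - n k.+1)
      - Ga^T *m (sigma *: residual k.+1 + x k.+1) + bb)) => // y _.
  have hy : (fun k => y - n k.+2) @ G --> y - nl.
    by apply: cvgB => //; exact: cvg_cst.
  have h1 : (fun k => dotv (dn k.+1) (y - n k.+2)) @ G --> (0 : R).
    apply: (small _ _ _ normN y nl setT) => //.
    - by move=> e; rewrite /normN !mulmxN !(dotvNl, dotvNr) !opprK.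
    - by apply: cvgD; [exact: cG|exact: cN].
  have h2 : (fun k => - (T *m (n k.+2 - n k.+1))
      - Ga^T *m (sigma *: residual k.+1 + x k.+1) + bb) @ G -->
      - (T *m 0) - Ga^T *m (sigma *: 0 + xl) + bb.
    apply: cvgD; last exact: cvg_cst.
    apply: cvgB; first by apply: cvgN; exact: cvg_mulmx.
    by apply: cvg_mulmx; apply: cvgD => //; exact: cvgZr.
  rewrite mulmx0 oppr0 scaler0 !add0r in h2.
  apply: (cvg_perturb_dotv GP h1 h2 hy) => k.
  by rewrite -dotvDl; congr dotv; vring.
Qed.

Lemma W_cluster ml nl xl (G : set_system nat) :
  kkt_pt ml nl xl -> ProperFilter G -> \oo `<=` G ->
  (fun k => m k.+2) @ G --> ml -> (fun k => n k.+2) @ G --> nl ->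
  (fun k => x k.+1) @ G --> xl ->
  (fun k => W ml nl xl k.+1) @ G --> (0 : R).
Proof.
move=> kkt GP sG hm hn hx.
have r0 := cvg_G sG (residual_cvg0 kkt).
have N0 := cvg_G sG (incr_n_cvg0 kkt).
have e0 (dim : nat) (u : nat -> 'cV[R]_dim) (l : 'cV[R]_dim) :
    u @ G --> l -> (fun k => u k - l) @ G --> (0 : 'cV[R]_dim).
  by move=> h; rewrite -(subrr l); apply: cvgB => //; exact: cvg_cst.
(* [W] at index [k + 1] involves [x k.+2], which shares the limit of [x k.+1] because the residual
   vanishes. *)
have hx2 : (fun k => x k.+2) @ G --> xl.
  have : (fun k => x k.+1 + (tau * sigma) *: residual k.+1) @ G -->
    xl + (tau * sigma) *: 0 by apply: cvgD => //; exact: cvgZr.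
  by rewrite scaler0 addr0; under eq_cvg do rewrite -x_step.
have hx0 := e0 _ _ _ hx2; have hm0 := e0 _ _ _ hm; have hn0 := e0 _ _ _ hn.
have -> : 0 = dotv (0 : 'cV[R]_dX) 0 / (tau * sigma)
  + sigma * dotv (Ga *m 0) (Ga *m 0)
  + dotv 0 (S *m 0) + dotv 0 (T *m 0)
  + sigma * (1 - alpha) * ((tau - 1) ^+ 2 / lam) * dotv (0 : 'cV[R]_dX) 0
  + (1 - alpha) * dotv 0 (T *m 0) by rewrite !dotv0l !mulmx0 !dotv0l; ring.
rewrite /W /lyap; repeat apply: cvgD.
- by apply: cvgMl; exact: cvg_dotv.
- by apply: cvgMr; apply: cvg_dotv; exact: cvg_mulmx.
- by apply: cvg_dotv => //; exact: cvg_mulmx.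
- by apply: cvg_dotv => //; exact: cvg_mulmx.
- by apply: cvgMr; exact: cvg_dotv.
- by apply: cvgMr; apply: cvg_dotv => //; exact: cvg_mulmx.
Qed.

Lemma kkt_convergence : (exists mb nb xb, kkt_pt mb nb xb) ->
  exists mb nb xb, [/\ kkt_pt mb nb xb,
    m @ \oo --> mb, n @ \oo --> nb & x @ \oo --> xb].
Proof.
move=> [mb [nb [xb kkt]]].
have [G [GU sG]] := ultraFilterLemma eventually_filter.
have GP : ProperFilter G by exact: ultra_proper.
have [v hv _] := fejer_cvg kkt; have hX := distance_cvg kkt hv.
have [C C0 hC] := distance_bound kkt.
have hB : \forall k \near G,
    W mb nb xb k + W mb nb xb k.+1 + decr mb k <= v + v + 0 + 1.
  apply: sG; near=> k; apply: ltW; near: k.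
  by apply: (cvgr_lt _ hX); rewrite ltrDl.
have ex dim (u : nat -> 'cV[R]_dim) (l : 'cV[R]_dim) :
    (forall k, dotv (u k - l) (u k - l) <=
      C * (W mb nb xb k + W mb nb xb k.+1 + decr mb k)) ->
    exists l' : 'cV[R]_dim, u @ G --> l'.
  move=> h.
  have [l' hl] : exists l' : 'cV[R]_dim, (fun k => u k - l) @ G --> l'.
    apply: (@ultra_bounded_cvg _ _ _ GU _ _ (C * (v + v + 0 + 1))).
    by apply: filterS hB => k hk; rewrite (le_trans (h k)) // ler_wpM2l.
  exists (l' + l).
  have : (fun k => u k - l + l) @ G --> l' + l by apply: cvgD => //; exact: cvg_cst.
  by under eq_cvg do rewrite subrK.
have [|ml hm] := ex _ (fun k => m k.+2) mb; first by move=> k; have [] := hC k.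
have [|nl hn] := ex _ (fun k => n k.+2) nb; first by move=> k; have [] := hC k.
have [|xl hx] := ex _ (fun k => x k.+1) xb; first by move=> k; have [] := hC k.
have kl : kkt_pt ml nl xl := cluster_kkt kkt GP sG hm hn hx.
exists ml, nl, xl.
have W0 := W_cluster kl GP sG hm hn hx.
have [w hw _] := fejer_cvg kl.
have hw1 : (fun k => W ml nl xl k.+1) @ \oo --> w by rewrite cvg_shiftS.
(* Quasi-Fejer monotonicity at the cluster point gives the full sequence a limit; [G] refines the
   tails and identifies it as 0. *)
have w0 : w = 0 by exact: (cvg_unique (@norm_hausdorff _ _) (cvg_G sG hw1) W0).
rewrite w0 in hw; have [] := cvg_of_W0 kl hw; by split.
Unshelve. all: by end_near. Qed.

End Convergence.

(** * Linear maps, subspaces and splitting off quadratic terms *)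

Section LinearMaps.
Context {R : realType}.

(** Linearity witnessed by an unnamed matrix, so that compositions of block and stage projections
    need no explicit matrices. *)
Definition mx_rep n p (g : 'cV[R]_n -> 'cV[R]_p) : Prop :=
  exists L : 'M[R]_(p, n), forall u, g u = L *m u.

Lemma mx_rep_id n : mx_rep (@id 'cV[R]_n).
Proof. by exists 1%:M => u; rewrite mul1mx. Qed.

Lemma mx_rep_usub n p k (g : 'cV[R]_k -> 'cV[R]_(n + p)) :
  mx_rep g -> mx_rep (fun u => usubmx (g u)).
Proof.
move=> [L hL]; exists (row_mx 1%:M 0 *m L) => u.
by rewrite -mulmxA -hL -{2}(vsubmxK (g u)) mul_row_col mul1mx mul0mx addr0.
Qed.

Lemma mx_rep_dsub n p k (g : 'cV[R]_k -> 'cV[R]_(n + p)) :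
  mx_rep g -> mx_rep (fun u => dsubmx (g u)).
Proof.
move=> [L hL]; exists (row_mx 0 1%:M *m L) => u.
by rewrite -mulmxA -hL -{2}(vsubmxK (g u)) mul_row_col mul1mx mul0mx add0r.
Qed.

Lemma mx_rep_opp n k (g : 'cV[R]_k -> 'cV[R]_n) :
  mx_rep g -> mx_rep (fun u => - g u).
Proof. by move=> [L hL]; exists (- L) => u; rewrite mulNmx hL. Qed.

Lemma affine_sup_comp n p (f : 'cV[R]_p -> \bar R) (g : 'cV[R]_n -> 'cV[R]_p) :
  mx_rep g -> affine_sup f -> affine_sup (fun u => f (g u)).
Proof.
move=> [L hL] /(affine_sup_mulmx L); congr affine_sup.
by apply/funext => u; rewrite hL.
Qed.

Lemma affine_sup0 n : affine_sup (fun _ : 'cV[R]_n => 0%E).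
Proof.
exists [set (0, 0)]; first by exists (0, 0).
move=> m rho; split=> [h _ ->|h] /=; first by rewrite dotv0l addr0 -lee_fin.
by have := h (0, 0) erefl; rewrite /= dotv0l addr0 lee_fin.
Qed.

Lemma cvg_mx_rep n p (g : 'cV[R]_n -> 'cV[R]_p) (F : set_system nat)
    (u : nat -> 'cV[R]_n) (l : 'cV[R]_n) : ProperFilter F -> mx_rep g ->
  u @ F --> l -> (fun k => g (u k)) @ F --> g l.
Proof.
move=> FP [L hL] hu; rewrite hL; under eq_cvg do rewrite hL.
exact: cvg_mulmx.
Qed.

Lemma dotv_col n p (u v : 'cV[R]_(n + p)) :
  dotv u v = dotv (usubmx u) (usubmx v) + dotv (dsubmx u) (dsubmx v).
Proof.
by rewrite -{1}(vsubmxK u) -{1}(vsubmxK v) /dotv tr_col_mx mul_row_col mxE.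
Qed.

(** Serves to show that the m-space is closed: a condition [L *m w = 0] passes to limits. *)
Lemma mxrangeP n p (Q : 'M[R]_(n, p)) w :
  mxrange Q w <-> (cokermx Q^T)^T *m w = 0.
Proof.
split=> [[u _ <-]|h].
  apply: trmx_inj; rewrite trmx_mul trmxK trmx0 trmx_mul -mulmxA.
  by rewrite mulmx_coker mulmx0.
have /submxP[B hB] : (w^T <= Q^T)%MS.
  by rewrite submxE; apply/eqP; apply: trmx_inj; rewrite trmx_mul trmxK trmx0.
by exists B^T => //; apply: trmx_inj; rewrite trmx_mul trmxK hB.
Qed.

(** Here [w] acts as the gradient of [phi] at [m]. In the subgradient inequality at
    [m + t *: (y - m)] the remainder of [phi] is of order [t^2], while [f] is bounded on the segment
    by convexity; small [t] leaves only the first-order terms. *)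
Lemma subdiff_add_smooth n (f g : 'cV[R]_n -> \bar R) (U : set 'cV[R]_n)
    (phi kappa : 'cV[R]_n -> R) m v w :
  affine_sup f -> (forall u, U u -> g u = (phi u)%:E) ->
  (forall u, ~ U u -> g u = +oo%E) ->
  (forall y t, U m -> U y -> U (m + t *: (y - m))) ->
  (forall d t, phi (m + t *: d) = phi m + t * dotv w d + t ^+ 2 * kappa d) ->
  subdiff (fun u => f u + g u)%E m v -> subgrad f U m (v - w).
Proof.
move=> hf gU gN Uc hphi [hfin hsub].
have fN u := affine_sup_gtNy u hf.
have Um : U m.
  apply: contrapT => /gN gm; move: hfin; rewrite gm.
  by have := fN m; case: (f m).
have [r fm] : exists r, f m = r%:E.
  move: hfin; rewrite (gU _ Um); have := fN m.
  by case: (f m) => // r _ _; exists r.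
split=> //; exists r => // y s Uy fy.
have -> : dotv (v - w) (y - m) = dotv v (y - m) - dotv w (y - m).
  by rewrite dotvDl dotvNl.
apply: (subdiff_smooth (kappa := kappa (y - m)) hf fm fy) => t _.
have := hsub (m + t *: (y - m)).
have -> : m + t *: (y - m) - m = t *: (y - m) by rewrite addrAC subrr add0r.
rewrite dotvZr fm (gU _ Um) (gU _ (Uc y t Um Uy)) hphi.
have := fN (m + t *: (y - m)); case: (f (m + t *: (y - m))) => [p| |] // _; last by move=> _; rewrite addye // leey.
rewrite -!EFinD !lee_fin => h; lra.
Qed.

Lemma subdiff_convex_quadratic n (g : 'cV[R]_n -> \bar R) (U : set 'cV[R]_n)
    (H : 'M[R]_n) (k : R) m :
  is_psd H -> U m ->
  (forall u, U u -> g u = (2^-1 * dotv u (H *m u) + k)%:E) ->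
  (forall u, ~ U u -> g u = +oo%E) -> subdiff g m (H *m m).
Proof.
move=> hH Um gU gN; split; first by rewrite gU.
move=> y; have [Uy|/gN ->] := pselect (U y); last by rewrite leey.
rewrite !gU // -EFinD lee_fin.
have := hH.2 (y - m); rewrite mulmxBr !dotvL (dotvC (H *m m)).
rewrite (dotvC (H *m m)) (sym_dotv y m hH.1) => h; lra.
Qed.

Lemma quad_expand n (H : 'M[R]_n) m d t : is_psd H ->
  2^-1 * dotv (m + t *: d) (H *m (m + t *: d)) =
  2^-1 * dotv m (H *m m) + t * dotv (H *m m) d
  + t ^+ 2 * (2^-1 * dotv d (H *m d)).
Proof.
move=> hH; rewrite mulmxDr -scalemxAr !dotvL (dotvC (H *m m) d).
by rewrite (sym_dotv m d hH.1); field.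
Qed.

Lemma enorm_expand n (a : 'cV[R]_n) b t (s : R) :
  s / 2 * enorm (a + t *: b) ^+ 2 =
  s / 2 * enorm a ^+ 2 + t * (s * dotv a b) + t ^+ 2 * (s / 2 * dotv b b).
Proof. by rewrite !enorm_sqr !dotvL (dotvC b a); field. Qed.

Lemma derive_dotv n (a u v : 'cV[R]_n) :
  'D_v (dotv a : 'cV[R]_n -> R^o) u = dotv a v.
Proof.
rewrite /derive; apply: cvg_lim => //.
apply: (@cvg_trans _ ((fun _ : R => dotv a v : R^o) @ 0^')); last exact: cvg_cst.
apply: near_eq_cvg; near=> h.
rewrite /= dotvDr addrK dotvZr.
have h0 : h != 0 by near: h; exact: nbhs_dnbhs_neq.
by rewrite /GRing.scale /= mulKf.
Unshelve. all: by end_near. Qed.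

End LinearMaps.

(** * The three-stage problem as an instance *)

Section Instance.
Context {R : realType} {d l N2 N3 : nat} (D : three_stage R d l N2 N3).
Local Notation dX := (tot N2 N3 d).
Local Notation dY := (tot N2 N3 l).

Lemma mx_rep_st1 k n (g : 'cV[R]_n -> 'cV[R]_(tot N2 N3 k)) :
  mx_rep g -> mx_rep (fun u => st1 (g u)).
Proof. exact: mx_rep_usub. Qed.

Lemma mx_rep_st2 k n (g : 'cV[R]_n -> 'cV[R]_(tot N2 N3 k)) :
  mx_rep g -> mx_rep (fun u => st2 (g u)).
Proof. by move=> h; apply: mx_rep_usub; exact: mx_rep_dsub. Qed.

Lemma mx_rep_st3 k n (g : 'cV[R]_n -> 'cV[R]_(tot N2 N3 k)) :
  mx_rep g -> mx_rep (fun u => st3 (g u)).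
Proof. by move=> h; apply: mx_rep_dsub; exact: mx_rep_dsub. Qed.

Lemma dotv_stages k (u v : 'cV[R]_(tot N2 N3 k)) :
  dotv u v = dotv (st1 u) (st1 v) + dotv (st2 u) (st2 v) + dotv (st3 u) (st3 v).
Proof. by rewrite dotv_col [X in _ + X]dotv_col addrA. Qed.

Lemma affine_sup_three k (f1 : 'cV[R]_d -> \bar R)
    (f2 : 'cV[R]_(scen N2 d) -> \bar R)
    (f3 : 'cV[R]_(scen N2 (scen N3 d)) -> \bar R) :
  Defs.proper f1 -> Defs.proper f2 -> Defs.proper f3 ->
  affine_sup (fun m : 'cV[R]_(dX + k) =>
    conjugate f1 (- st1 (usubmx m)) + conjugate f2 (- st2 (usubmx m))
    + conjugate f3 (- st3 (usubmx m)))%E.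
Proof.
move=> h1 h2 h3.
have hu : mx_rep (fun m : 'cV[R]_(dX + k) => usubmx m).
  exact/mx_rep_usub/mx_rep_id.
apply: affine_sup_add; first apply: affine_sup_add.
- apply: (affine_sup_comp (mx_rep_opp (mx_rep_st1 hu))).
  exact: affine_sup_conjugate.
- apply: (affine_sup_comp (mx_rep_opp (mx_rep_st2 hu))).
  exact: affine_sup_conjugate.
- apply: (affine_sup_comp (mx_rep_opp (mx_rep_st3 hu))).
  exact: affine_sup_conjugate.
Qed.

Lemma proper_indic n (K : set 'cV[R]_n) : K !=set0 -> Defs.proper (indic_fun K).
Proof.
move=> [x Kx]; split; first by exists x; rewrite /indic_fun mem_set.
by move=> y; rewrite /indic_fun; case: ifP.
Qed.

Lemma Qmx_stages (w : 'cV[R]_dX) :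
  [/\ st1 (Qmx D *m w) = Q1 D *m st1 w, st2 (Qmx D *m w) = Q2 D *m st2 w &
      st3 (Qmx D *m w) = Q3 D *m st3 w].
Proof.
rewrite /Qmx -(vsubmxK w) -{1 3 5}(vsubmxK (dsubmx w)) /st1 /st2 /st3.
rewrite !mul_block_col !mul0mx !addr0 !add0r.
by rewrite !(col_mxKu, col_mxKd).
Qed.

Lemma mspaceP (m : 'cV[R]_(dX + dX)) :
  mspace D m <-> mxrange (Qmx D) (dsubmx m).
Proof.
split=> [[[u1 _ h1] [u2 _ h2] [u3 _ h3]]|[u _ hu]].
  exists (col_mx u1 (col_mx u2 u3)) => //.
  rewrite /Qmx !mul_block_col !mul0mx !addr0 !add0r h1 h2 h3.
  by rewrite !vsubmxK.
by rewrite /mspace /= -hu; have [-> -> ->] := Qmx_stages u; split; eexists.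
Qed.

Lemma mspace_lin (a : R) m m' :
  mspace D m -> mspace D m' -> mspace D (m + a *: m').
Proof.
move=> /mspaceP[u _ hu] /mspaceP[u' _ hu']; apply/mspaceP.
exists (u + a *: u') => //.
by rewrite mulmxDr -scalemxAr hu hu' !linearD !linearZ.
Qed.

Lemma mspaceB m m' : mspace D m -> mspace D m' -> mspace D (m - m').
Proof. by move=> h h'; rewrite -scaleN1r; exact: mspace_lin. Qed.

Lemma mspace_closed (F : set_system nat) (u : nat -> 'cV[R]_(dX + dX))
    (v : 'cV[R]_(dX + dX)) : ProperFilter F ->
  (forall k, mspace D (u k)) -> u @ F --> v -> mspace D v.
Proof.
move=> FP hU hu; apply/mspaceP/mxrangeP.
have hd : (fun k => dsubmx (u k)) @ F --> dsubmx v.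
  by apply: (cvg_mx_rep FP _ hu); exact/mx_rep_dsub/mx_rep_id.
have h : (fun k => (cokermx (Qmx D)^T)^T *m dsubmx (u k)) @ F -->
  (cokermx (Qmx D)^T)^T *m dsubmx v by exact: cvg_mulmx.
have h0 : (fun k => (cokermx (Qmx D)^T)^T *m dsubmx (u k)) @ F -->
    (0 : 'cV[R]_dX).
  rewrite (_ : (fun k => _) = fun=> 0); first exact: cvg_cst.
  by apply/funext => k; apply/mxrangeP/mspaceP.
exact: (cvg_unique (@norm_hausdorff _ _) h h0).
Qed.

Definition Qw : 'M[R]_(dX + dX) := block_mx 0 0 0 (Qmx D).

Definition fconst (x' : 'cV[R]_dX) : R :=
  - h1 D (st1 x') - 2^-1 * dotv (st1 x') (Q1 D *m st1 x')
    + dotv (grad (h1 D) (st1 x')) (st1 x')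
  + (- h2 D (st2 x') - 2^-1 * dotv (st2 x') (Q2 D *m st2 x')
    + dotv (grad (h2 D) (st2 x')) (st2 x'))
  + (- h3 D (st3 x') - 2^-1 * dotv (st3 x') (Q3 D *m st3 x')
    + dotv (grad (h3 D) (st3 x')) (st3 x')).

Lemma Qw_mul (m : 'cV[R]_(dX + dX)) : Qw *m m = col_mx 0 (Qmx D *m dsubmx m).
Proof. by rewrite -{1}(vsubmxK m) /Qw mul_block_col !mul0mx !add0r. Qed.

Lemma dotv_Qw (u m : 'cV[R]_(dX + dX)) :
  dotv u (Qw *m m) = dotv (dsubmx u) (Qmx D *m dsubmx m).
Proof. by rewrite Qw_mul dotv_col col_mxKu col_mxKd dotv0r add0r. Qed.

Lemma fquadE m x' : mspace D m ->
  fquad D m x' = (2^-1 * dotv m (Qw *m m) + fconst x')%:E.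
Proof.
move=> [r1 r2 r3]; rewrite /fquad /f_stage /indic_fun !mem_set //.
rewrite -!EFinD dotv_Qw dotv_stages; have [-> -> ->] := Qmx_stages (dsubmx m).
by rewrite /fconst; congr (_%:E); ring.
Qed.

Lemma fquad_pinfty m x' : ~ mspace D m -> fquad D m x' = +oo%E.
Proof.
move=> hm; have [r1|r1] := pselect (mxrange (Q1 D) (st1 (dsubmx m))); last first.
  by rewrite /fquad /f_stage /indic_fun (memNset r1); do 2 case: ifP => _.
have [r2|r2] := pselect (mxrange (Q2 D) (st2 (dsubmx m))); last first.
  by rewrite /fquad /f_stage /indic_fun (memNset r2); do 2 case: ifP => _.
have [r3|r3] := pselect (mxrange (Q3 D) (st3 (dsubmx m))); last first.
  by rewrite /fquad /f_stage /indic_fun (memNset r3); do 2 case: ifP => _.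
by case: hm.
Qed.

Definition bvec : 'cV[R]_(dX + dY) :=
  col_mx 0 (col_mx (b1 D) (col_mx (b2 D) (b3 D))).

Lemma glinE n : glin D n = - dotv bvec n.
Proof.
rewrite /glin /bvec dotv_col col_mxKu col_mxKd dotv0l add0r dotv_stages.
by rewrite /st1 /st2 /st3 !(col_mxKu, col_mxKd).
Qed.

Lemma grad_glin n : grad (glin D) n = - bvec.
Proof.
apply/matrixP => i j; rewrite (ord1 j) !mxE.
have -> : glin D = dotv (- bvec).
  by apply/funext => v; rewrite glinE dotvNl.
rewrite derive_dotv dotvE (bigD1 i) //= big1 => [|k ki].
  by rewrite !mxE !eqxx mulr1 addr0.
by rewrite !mxE (negbTE ki) mulr0.
Qed.

Hypothesis P_sup : affine_sup (pfun D).
Hypothesis q_sup : affine_sup (qfun D).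
Hypothesis Qpsd : is_psd (Qmx D).

Lemma Qw_psd : is_psd Qw.
Proof.
apply: psd_block => //; split; first by rewrite trmx0.
by move=> u; rewrite mul0mx dotv0r.
Qed.

Lemma m_step_subgrad sigma x' n x m v : sigma != 0 ->
  subdiff (Lhat_m D sigma x' n x) m v ->
  subgrad (pfun D) (mspace D) m (v - (Fadj D)^T *m
    (sigma *: (Fadj D *m m + Gadj D *m n - cvec D x') + x) - Qw *m m).
Proof.
move=> s0.
have -> : Lhat_m D sigma x' n x = fun m => (pfun D m
    + (fquad D m x' + (penalty D sigma x' m n x)%:E))%E.
  by apply/funext => u; rewrite /Lhat_m -addeA.
set rho := Fadj D *m m + Gadj D *m n - cvec D x' + sigma^-1 *: x.
have -> : sigma *: (Fadj D *m m + Gadj D *m n - cvec D x') + x = sigma *: rho.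
  by rewrite /rho [RHS]scalerDr scalerA mulfV // scale1r.
have -> : v - (Fadj D)^T *m (sigma *: rho) - Qw *m m =
  v - ((Fadj D)^T *m (sigma *: rho) + Qw *m m) by rewrite opprD addrA.
apply: (@subdiff_add_smooth _ _ _ _ _ (fun u =>
    2^-1 * dotv u (Qw *m u) + fconst x' + penalty D sigma x' u n x)
  (fun u => 2^-1 * dotv u (Qw *m u)
     + sigma / 2 * dotv (Fadj D *m u) (Fadj D *m u)) _ _ _ P_sup).
- by move=> u Uu; rewrite fquadE // -EFinD.
- by move=> u Uu; rewrite fquad_pinfty.
- by move=> y t Um Uy; apply: mspace_lin => //; exact: mspaceB.
- move=> e t; rewrite quad_expand; last exact: Qw_psd.
  rewrite /penalty.
  have -> : Fadj D *m (m + t *: e) + Gadj D *m n - cvec D x' + sigma^-1 *: x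
     = rho + t *: (Fadj D *m e).
    by rewrite /rho mulmxDr -scalemxAr; vring.
  rewrite enorm_expand -/rho; clearbody rho.
  by rewrite dotvDl dotv_trl dotvZl; ring.
Qed.

Lemma n_step_subgrad sigma x' n x m v : sigma != 0 ->
  subdiff (Lhat_n D sigma x' m x) n v ->
  subgrad (qfun D) setT n (v - (Gadj D)^T *m
    (sigma *: (Fadj D *m m + Gadj D *m n - cvec D x') + x) + bvec).
Proof.
move=> s0; rewrite /Lhat_n.
set rho := Fadj D *m m + Gadj D *m n - cvec D x' + sigma^-1 *: x.
have -> : sigma *: (Fadj D *m m + Gadj D *m n - cvec D x') + x = sigma *: rho.
  by rewrite /rho [RHS]scalerDr scalerA mulfV // scale1r.
have -> : v - (Gadj D)^T *m (sigma *: rho) + bvec =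
  v - ((Gadj D)^T *m (sigma *: rho) - bvec) by rewrite opprB addrA addrAC.
apply: (@subdiff_add_smooth _ _ _ _ _ (fun u =>
    glin D u + penalty D sigma x' m u x)
  (fun u => sigma / 2 * dotv (Gadj D *m u) (Gadj D *m u)) _ _ _ q_sup) => // [u /(_ I)//|e t].
rewrite !glinE /penalty.
have -> : Fadj D *m m + Gadj D *m (n + t *: e) - cvec D x' + sigma^-1 *: x
   = rho + t *: (Gadj D *m e).
  by rewrite /rho mulmxDr -scalemxAr; vring.
rewrite enorm_expand -/rho; clearbody rho.
by rewrite !dotvL dotv_trl dotvZl; ring.
Qed.

Lemma KKT_subgrad m n x : KKT D m n x ->
  [/\ subgrad (pfun D) (mspace D) m (- ((Fadj D)^T *m x) - Qw *m m),
      subgrad (qfun D) setT n (- ((Gadj D)^T *m x) + bvec) &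
      Fadj D *m m + Gadj D *m n = cvec D x].
Proof.
move=> [[u [s [[pfin pu] fs us]]] [u' [qfin qu] hu] hc]; split=> //.
  (* Splitting with [f = 0] gives [<s - Qw m, y - m> <= 0] for [y] in the m-space; added to the
     inequality for [u], it replaces [s] by [Qw *m m]. *)
  have hs : subgrad (fun=> 0%E) (mspace D) m (s - Qw *m m).
    apply: (@subdiff_add_smooth _ _ _ (fquad D ^~ x) _ (fun u =>
      2^-1 * dotv u (Qw *m u) + fconst x)
      (fun u => 2^-1 * dotv u (Qw *m u)) _ _ _ (affine_sup0 _)).
    - by move=> y Uy; rewrite fquadE.
    - by move=> y Uy; rewrite fquad_pinfty.
    - by move=> y t Um Uy; apply: mspace_lin => //; exact: mspaceB.
    - by move=> e t; rewrite quad_expand; [ring|exact: Qw_psd].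
    - by under eq_fun do rewrite add0e.
  have [Um [_ [<-] hsU]] := hs; split=> //.
  have [r pm] : exists r, pfun D m = r%:E.
    by move: pfin; case: (pfun D m) => // r _; exists r.
  exists r => // y t Uy py; have := hsU y 0 Uy erefl.
  have := pu y; rewrite pm py -EFinD lee_fin.
  have -> : - ((Fadj D)^T *m x) = u + s.
    by apply/eqP; rewrite eq_sym -subr_eq0 opprK -[X in _ + X]/(Fmx D *m x) us.
  by rewrite !dotvL; lra.
split=> //; have [r pn] : exists r, qfun D n = r%:E.
  by move: qfin; case: (qfun D n) => // r _; exists r.
exists r => // y t _ qy; have := qu y; rewrite pn qy -EFinD lee_fin.
have -> // : - ((Gadj D)^T *m x) + bvec = u'.
rewrite grad_glin in hu; apply/matrixP => i j.
have /matrixP/(_ i j) := hu.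
by rewrite -[(Gadj D)^T]/(Gmx D) !(mxDE, mxNE) [X in _ = X -> _]mxE; lra.
Qed.

Lemma pfun_usub m m' : usubmx m = usubmx m' -> pfun D m = pfun D m'.
Proof. by rewrite /pfun => ->. Qed.

(** [KKT] asks for a subgradient of [pfun] on the whole space, whereas [subgrad] tests only points
    of the m-space. Since [pfun] depends on the [v]-part alone, it suffices that the [w]-part of the
    subgradient vanishes, which is the equation [Q w = Q x]. *)
Lemma subgrad_KKT m n x :
  subgrad (pfun D) (mspace D) m (- ((Fadj D)^T *m x) - Qw *m m) ->
  subgrad (qfun D) setT n (- ((Gadj D)^T *m x) + bvec) ->
  Fadj D *m m + Gadj D *m n = cvec D x -> KKT D m n x.
Proof.
move=> [Um [r pm hP]] [_ [r' qn hQ]] hc.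
set v := - ((Fadj D)^T *m x) - Qw *m m in hP.
have vE : v = col_mx (- x) (Qmx D *m (x - dsubmx m)).
  rewrite /v Qw_mul /Fadj tr_row_mx mul_col_mx trmx1 mul1mx linearN /= Qpsd.1.
  by rewrite mulNmx opp_col_mx opp_col_mx add_col_mx opprK oppr0 addr0 mulmxBr.
(* The [w]-part of [v] is [Qmx D *m (x - dsubmx m)], hence an admissible direction in the m-space.
   [pfun] is constant along it, so the inequality reads [|dsubmx v|^2 <= 0]. *)
have v0 : dsubmx v = 0.
  have := hP (m + col_mx 0 (dsubmx v)) r.
  have -> : pfun D (m + col_mx 0 (dsubmx v)) = r%:E.
    by rewrite -pm; apply: pfun_usub; rewrite linearD /= col_mxKu addr0.
  have Uy : mspace D (m + col_mx 0 (dsubmx v)).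
    rewrite -[col_mx _ _]scale1r; apply: mspace_lin => //; apply/mspaceP.
    by rewrite col_mxKd vE col_mxKd; eexists.
  move=> /(_ Uy erefl); rewrite addrAC subrr add0r dotv_col col_mxKu col_mxKd.
  rewrite dotv0r add0r => h; apply: dotv_eq0.
  by apply/eqP; rewrite eq_le dotv_ge0 andbT; lra.
split=> //.
  exists v, (Qw *m m); split.
  - split; first by rewrite pm.
    move=> y; have := affine_sup_gtNy y P_sup.
    case py : (pfun D y) => [s| |] // _; last by rewrite leey.
    rewrite pm -EFinD lee_fin.
    (* Giving [y] the [w]-part of [m] brings it into the m-space and changes neither [pfun] nor the
       pairing with [v]. *)
    pose y' := col_mx (usubmx y) (dsubmx m).
    have py' : pfun D y' = s%:E.
      by rewrite -py; apply: pfun_usub; rewrite col_mxKu.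
    have Uy' : mspace D y' by apply/mspaceP; rewrite col_mxKd; exact/mspaceP.
    have := hP y' s Uy' py'.
    by rewrite !(dotv_col v) v0 !dotv0l !linearB /= col_mxKu.
  - apply: (subdiff_convex_quadratic (U := mspace D) (k := fconst x)) => //.
    + exact: Qw_psd.
    + by move=> y Uy; rewrite fquadE.
    + by move=> y Uy; rewrite fquad_pinfty.
  - by rewrite /v subrK addNr.
exists (- ((Gadj D)^T *m x) + bvec); last first.
  by rewrite grad_glin addrK addNr.
split; first by rewrite qn.
move=> y; have := affine_sup_gtNy y q_sup.
case qy : (qfun D y) => [s| |] // _; last by rewrite leey.
by rewrite qn -EFinD lee_fin; exact: hQ.
Qed.

End Instance.

(** * Gradient of the stage sum and continuity of [cvec] *)

Section Gradient.
Context {R : realType}.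

(** Because the quotients agree as functions of [t], derivability and the derivative transfer
    together, without a chain rule. *)
Lemma diff_quot_comp n p (h : 'cV[R]_p -> R^o) (g : 'cV[R]_n -> 'cV[R]_p) u v :
  mx_rep g ->
  (fun t : R => t^-1 *: (((fun u => h (g u)) \o shift u) (t *: v) - h (g u))) =
  (fun t : R => t^-1 *: ((h \o shift (g u)) (t *: g v) - h (g u))).
Proof.
move=> [L hL]; apply/funext => t /=.
by rewrite !hL mulmxDr -scalemxAr.
Qed.

Lemma derive_comp_lin n p (h : 'cV[R]_p -> R) (g : 'cV[R]_n -> 'cV[R]_p) u v :
  mx_rep g ->
  'D_v ((fun u => h (g u)) : 'cV[R]_n -> R^o) u =
  'D_(g v) (h : 'cV[R]_p -> R^o) (g u).
Proof.
by move=> hg; rewrite /derive (diff_quot_comp _ _ _ hg).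
Qed.

Lemma derivable_comp_lin n p (h : 'cV[R]_p -> R) (g : 'cV[R]_n -> 'cV[R]_p) u v :
  mx_rep g -> derivable (h : 'cV[R]_p -> R^o) (g u) (g v) ->
  derivable ((fun u => h (g u)) : 'cV[R]_n -> R^o) u v.
Proof.
by move=> hg; rewrite /derivable (diff_quot_comp _ _ _ hg).
Qed.

Lemma derive_grad n (h : 'cV[R]_n -> R) u v :
  differentiable (h : 'cV[R]_n -> R^o) u ->
  'D_v (h : 'cV[R]_n -> R^o) u = dotv (grad h u) v.
Proof.
move=> hd; rewrite deriveE // dotvE.
rewrite {1}(matrix_sum_delta v) linear_sum; apply: eq_bigr => i _.
by rewrite big_ord1 linearZ /= mxE deriveE // mulrC.
Qed.

Lemma lipschitz_grad_cvg n (h : 'cV[R]_n -> R) (F : set_system nat)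
    (u : nat -> 'cV[R]_n) (a : 'cV[R]_n) : ProperFilter F -> convex_C11 h ->
  u @ F --> a -> (fun k => grad h (u k)) @ F --> grad h a.
Proof.
move=> FP [_ _ [L hL]] hu; apply: cvg_dotvB.
have hua : (fun k => u k - a) @ F --> (0 : 'cV[R]_n).
  by rewrite -(subrr a); apply: cvgB => //; exact: cvg_cst.
have h0 : (fun k => L ^+ 2 * dotv (u k - a) (u k - a)) @ F --> (0 : R).
  by rewrite -(mulr0 (L ^+ 2)) -(dotv0l (0 : 'cV[R]_n)); apply: cvgMr; exact: cvg_dotv.
apply: (squeeze0 _ h0) => k; rewrite dotv_ge0 /= -!enorm_sqr -exprMn.
have h1 := hL (u k) a; have h2 := enorm_ge0 (grad h (u k) - grad h a).
by rewrite ler_sqr ?nnegrE //; exact: le_trans h1.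
Qed.

End Gradient.

Section Instance2.
Context {R : realType} {d l N2 N3 : nat} (D : three_stage R d l N2 N3).
Local Notation dX := (tot N2 N3 d).
Local Notation dY := (tot N2 N3 l).

(** Reduces continuity of the gradient of [hfun] to that of the stage gradients, which are
    Lipschitz. *)
Lemma grad_hfunE (x : 'cV[R]_dX) i :
  convex_C11 (h1 D) -> convex_C11 (h2 D) -> convex_C11 (h3 D) ->
  grad (hfun D) x i 0 =
    dotv (grad (h1 D) (st1 x)) (st1 (delta_mx i 0))
    + dotv (grad (h2 D) (st2 x)) (st2 (delta_mx i 0))
    + dotv (grad (h3 D) (st3 x)) (st3 (delta_mx i 0)).
Proof.
move=> [_ d1 _] [_ d2 _] [_ d3 _]; rewrite mxE.
have m1 : mx_rep (fun u : 'cV[R]_dX => st1 u) by exact/mx_rep_st1/mx_rep_id.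
have m2 : mx_rep (fun u : 'cV[R]_dX => st2 u) by exact/mx_rep_st2/mx_rep_id.
have m3 : mx_rep (fun u : 'cV[R]_dX => st3 u) by exact/mx_rep_st3/mx_rep_id.
have D1 := derivable_comp_lin m1 (diff_derivable (v := st1 (delta_mx i 0)) (d1 (st1 x))).
have D2 := derivable_comp_lin m2 (diff_derivable (v := st2 (delta_mx i 0)) (d2 (st2 x))).
have D3 := derivable_comp_lin m3 (diff_derivable (v := st3 (delta_mx i 0)) (d3 (st3 x))).
rewrite -!derive_grad // -(derive_comp_lin _ _ _ m1) -(derive_comp_lin _ _ _ m2).
rewrite -(derive_comp_lin _ _ _ m3) -deriveD // -deriveD //.
exact: derivableD.
Qed.

Lemma cvec_cvg (F : set_system nat) (u : nat -> 'cV[R]_dX) (a : 'cV[R]_dX) :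
  convex_C11 (h1 D) -> convex_C11 (h2 D) -> convex_C11 (h3 D) ->
  ProperFilter F -> u @ F --> a -> (fun k => cvec D (u k)) @ F --> cvec D a.
Proof.
move=> c1 c2 c3 FP hu; apply: cvgB; last exact: cvg_mulmx.
apply: cvg_cVP => i; under eq_cvg do rewrite grad_hfunE //.
rewrite grad_hfunE //; apply: cvgD; first apply: cvgD.
- apply: cvg_dotv; last exact: cvg_cst.
  apply: lipschitz_grad_cvg => //.
  by apply: (cvg_mx_rep FP _ hu); exact/mx_rep_st1/mx_rep_id.
- apply: cvg_dotv; last exact: cvg_cst.
  apply: lipschitz_grad_cvg => //.
  by apply: (cvg_mx_rep FP _ hu); exact/mx_rep_st2/mx_rep_id.
- apply: cvg_dotv; last exact: cvg_cst.
  apply: lipschitz_grad_cvg => //.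
  by apply: (cvg_mx_rep FP _ hu); exact/mx_rep_st3/mx_rep_id.
Qed.

Lemma mbasis_mspace b : mspace D (mbasis D *m b).
Proof.
apply/mspaceP; rewrite /mbasis -(vsubmxK b) mul_block_col col_mxKd mul0mx add0r.
have /row_freeP[B hB] := row_base_free (Qmx D).
exists (B *m dsubmx b) => //.
have := congr1 (mulmx (col_base (Qmx D))) hB.
by rewrite mulmxA mulmx_base mulmx1 mulmxA => ->.
Qed.

Lemma mspace_mbasis m : mspace D m -> exists b, m = mbasis D *m b.
Proof.
move=> /mspaceP[u _ hu]; exists (col_mx (usubmx m) (row_base (Qmx D) *m u)).
rewrite /mbasis mul_block_col !mul0mx mul1mx addr0 add0r mulmxA mulmx_base hu.
by rewrite vsubmxK.
Qed.

Lemma mbasis_inj (b : 'cV[R]_(dX + \rank (Qmx D))) : mbasis D *m b = 0 -> b = 0.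
Proof.
have /row_fullP[B hB] := col_base_full (Qmx D).
rewrite -{1}(vsubmxK b) /mbasis mul_block_col !mul0mx mul1mx addr0 add0r.
rewrite -[X in _ = X -> _](vsubmxK 0) => /eq_col_mx[h1 h2].
rewrite -(vsubmxK b) h1 linear0 -[dsubmx b]mul1mx -hB -mulmxA h2 linear0 mulmx0.
by rewrite col_mx0.
Qed.

End Instance2.

Theorem theorem3p5 (R : realType) (d l N2 N3 : nat)
    (D : three_stage R d l N2 N3)
    (alpha sigma tau : R) (eps : nat -> R)
    (m : nat -> 'cV[R]_(tot N2 N3 d + tot N2 N3 d))
    (n : nat -> 'cV[R]_(tot N2 N3 d + tot N2 N3 l))
    (x : nat -> 'cV[R]_(tot N2 N3 d)) :
  standing_assumptions D ->
  0 < alpha < 1 ->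
  0 < sigma ->
  0 < tau <= (1 + Num.sqrt (5 - 4 * alpha)) / 2 ->
  (forall k, 0 <= eps k) ->
  cvgn (series eps) ->
  pos_def_on (mspace D) (diag_part (shape_m d N2 N3) (Mtilde D sigma)) ->
  pos_def_on setT (diag_part (shape_n d l N2 N3) (Ntilde D sigma)) ->
  (exists mb nb xb, KKT D mb nb xb) ->
  algorithmB D sigma tau eps m n x ->
  (forall k mb nb xb, KKT D mb nb xb ->
    exists Pk, mean_value_op D xb (x k) Pk /\
      is_psd ((2 * alpha / sigma)%:M - (Pk - Qmx D))) ->
  exists mb nb xb,
    [/\ KKT D mb nb xb, m @ \oo --> mb, n @ \oo --> nb & x @ \oo --> xb].
Proof.
move=> [_ [[_ pr1 _] [_ pr2 _] [_ pr3 _]] [c1 c2 c3]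
  [[k1 _ _] [k2 _ _] [k3 _ _]] [[q1 _] [q2 _] [q3 _]]].
move=> alpha01 sigma0 tau01 eps0 eps_sum Hm Hn hKKT [m0 alg] hmv.
have P_sup : affine_sup (pfun D) by exact: affine_sup_three.
have q_sup : affine_sup (qfun D).
  by apply: affine_sup_three; exact: proper_indic.
have Qpsd : is_psd (Qmx D) by do 2 apply: psd_block => //.
have s_neq0 : sigma != 0 by exact: lt0r_neq0.
have [lam [lam0 cr0 cg0]] := step_length_coefs alpha01 sigma0 tau01.
have /andP[tau0 _] := tau01.
have gram_psd p q (A : 'M[R]_(p, q)) : is_psd (sigma *: (A^T *m A)).
  by apply: psdZ; [exact: ltW|exact: psd_gram].
have Mpsd : is_psd (Mtilde D sigma).
  by apply: psdD; [exact: Qw_psd|exact: gram_psd].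
have [S_psd M_pd] := sGS_pos_def (inv := inv_on (mbasis D)) (mbasis_mspace (D := D))
  (mbasis_inj (D := D)) Mpsd Hm erefl.
(* On the n-side definiteness holds on the whole space; [E = 1%:M] makes [invmx] a case of [inv_on],
   so the same lemmas serve both blocks. *)
have [T_psd N_pd] := sGS_pos_def (E := 1%:M) (inv := invmx)
  (fun=> I) (fun b (h : 1%:M *m b = 0) => etrans (esym (mul1mx b)) h)
  (gram_psd _ _ (Gadj D)) Hn (esym (inv_on1 _)).
rewrite -[sGS _ _ _]/(Sop D sigma) in S_psd M_pd.
rewrite -[sGS _ _ _]/(Top D sigma) in T_psd N_pd.
have normME e : dotv e (Mop D sigma *m e) =
    normM (Fadj D) (Qw D) (Sop D sigma) sigma e.
  by rewrite /Mop /Mtilde /normM !mulmxDl !dotvDr -scalemxAl dotvZr -mulmxA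
    /Fmx -dotv_mull.
have normNE e : dotv e (Nop D sigma *m e) =
    normN (Gadj D) (Top D sigma) sigma e.
  by rewrite /Nop /Ntilde /normN !mulmxDl !dotvDr -scalemxAl dotvZr -mulmxA
    /Gmx -dotv_mull.
have /choice[dm hdm] k : exists dm,
    subgrad (pfun D) (mspace D) (m k.+1)
      (dm - Sop D sigma *m (m k.+1 - m k) - (Fadj D)^T *m
        (sigma *: (Fadj D *m m k.+1 + Gadj D *m n k - cvec D (x k)) + x k)
       - Qw D *m m k.+1) /\
    forall e, mspace D e -> 2 * dotv dm e <=
      eps k * (1 + normM (Fadj D) (Qw D) (Sop D sigma) sigma e).
  have [[dm [_ hs [H hH hle]]] _ _] := alg k.
  exists dm; split; first exact: m_step_subgrad.
  move=> e /mspace_mbasis[b ->]; rewrite -normME; exact: inv_on_young hle.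
have /choice[dn hdn] k : exists dn,
    subgrad (qfun D) setT (n k.+1)
      (dn - Top D sigma *m (n k.+1 - n k) - (Gadj D)^T *m
        (sigma *: (Fadj D *m m k.+1 + Gadj D *m n k.+1 - cvec D (x k)) + x k)
       + bvec D) /\
    forall e, 2 * dotv dn e <=
      eps k * (1 + normN (Gadj D) (Top D sigma) sigma e).
  have [_ [dn [hs [H hH hle]]] _] := alg k.
  exists dn; split; first exact: n_step_subgrad.
  move=> e; rewrite -normNE -{1 2 3}(mul1mx e); rewrite -inv_on1 in hH.
  exact: inv_on_young hle.
have M_coer : exists2 C, 0 <= C & forall e, mspace D e ->
    dotv e e <= C * normM (Fadj D) (Qw D) (Sop D sigma) sigma e.
  have [C C0 hC] := range_coercive M_pd; exists C => // e /mspace_mbasis[b ->].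
  by rewrite -normME; exact: hC.
have N_coer : exists2 C, 0 <= C & forall e,
    dotv e e <= C * normN (Gadj D) (Top D sigma) sigma e.
  have [C C0 hC] := range_coercive N_pd; exists C => // e.
  by rewrite -normNE; have := hC e; rewrite mul1mx.
have c_metric mb nb xb k :
    kkt_pt (Fadj D) (Gadj D) (Qw D) (pfun D) (qfun D) (mspace D) (bvec D)
      (cvec D) mb nb xb ->
    exists E, [/\ is_psd E, is_psd ((2 * alpha / sigma)%:M - E) &
      cvec D (x k) - cvec D xb = E *m (x k - xb)].
  move=> [k4 k5 k6].
  (* The bound on [Pk] is available at points of [KKT], so the abstract point is translated back
     first. Then [E = Pk - Qmx D], because [cvec] subtracts [Qmx D *m x] from the gradient. *)
  have [Pk [[_ _ hgrad hE] hB]] := hmv k _ _ _ (subgrad_KKT P_sup q_sup Qpsd k4 k5 k6).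
  exists (Pk - Qmx D); split=> //.
  by rewrite mulmxBl -hgrad /cvec mulmxBr !opprD !opprK addrACA.
have [mb0 [nb0 [xb0 /(KKT_subgrad Qpsd) kkt0]]] := hKKT.
have [mb [nb [xb [[k4 k5 k6] hm hn hx]]]] := kkt_convergence (Qw_psd Qpsd)
  S_psd T_psd sigma0 alpha01 tau0 lam0 cr0 cg0 P_sup q_sup
  (@mspaceB _ _ _ _ _ D) eps0 eps_sum (fun k => (hdm k).2) (fun k => (hdn k).2)
  M_coer N_coer (fun k => (hdm k).1) (fun k => (hdn k).1)
  (fun k => let: And3 _ _ h := alg k in h) c_metric (@mspace_closed _ _ _ _ _ D)
  (fun F u a => cvec_cvg c1 c2 c3) (ex_intro _ mb0 (ex_intro _ nb0
    (ex_intro _ xb0 kkt0))).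
by exists mb, nb, xb; split=> //; exact: subgrad_KKT k4 k5 k6.
Qed.
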